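(* Consider the $N$ heterogeneous agents $$\dot x_i=A_ix_i+B_iu_i,\qquad y_i=C_ix_i,\qquad i=1,\dots,N,$$ with $x_i\in\mathbb{R}^{n_i}$, $u_i\in\mathbb{R}^{p_i}$, $y_i\in\mathbb{R}^{q}$ and constant real matrices $A_i,B_i,C_i$ of compatible sizes. Suppose that: (1) for each $i$, the local cost function $f_i:\mathbb{R}^q\to\mathbb{R}$ is continuously differentiable and strongly convex with constant $m_i>0$, and $\nabla f_i$ is globally Lipschitz on $\mathbb{R}^q$ with constant $M_i>0$; (2) the communication digraph $\mathcal{G}$, with adjacency matrix $[a_{ij}]\in\mathbb{R}^{N\times N}$ and Laplacian $\mathcal{L}$, is strongly connected (it is not required to be weight-balanced); (3) for each $i$, $(A_i,B_i)$ is stabilizable and $$\operatorname{rank}\begin{bmatrix} C_iB_i & \mathbf{0}_{q\times p_i}\\ -A_iB_i & B_i\end{bmatrix}=n_i+q .$$ For each $i$, let $K_i\in\mathbb{R}^{p_i\times n_i}$ be such that $A_i-B_iK_i$ is Hurwitz, and let $(\Upsilon_i,\Phi_i,\Psi_i)$ be a solution of the linear matrix equations $$C_i\Psi_i-I_q=\mathbf{0},\qquad B_i\Phi_i-A_i\Psi_i=\mathbf{0},\qquad B_i\Upsilon_i-\Psi_i=\mathbf{0}.$$ Then there exist positive constants $\gamma_1$ and $\gamma_2$ such that, under the distributed state feedback controller $$\begin{aligned} u_i&=-K_ix_i+\Upsilon_i\omega_i-(\Phi_i-K_i\Psi_i)\rho_i,\\ \dot\rho_i&=\omega_i:=-\frac{\nabla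 f_i(y_i)}{z_i^i}-\gamma_1\sum_{j=1}^N a_{ij}(y_i-y_j)-\gamma_2v_i,\\ \dot v_i&=\gamma_1\sum_{j=1}^N a_{ij}(y_i-y_j),\\ \dot z_i&=-\sum_{j=1}^N a_{ij}(z_i-z_j), \end{aligned}\qquad i=1,\dots,N,$$ where $\rho_i,v_i\in\mathbb{R}^q$, $z_i=(z_i^1,\dots,z_i^N)^{\mathrm T}\in\mathbb{R}^N$, with initial values $v_i(0)=\mathbf{0}$, $z_i^i(0)=1$, $z_i^j(0)=0$ for $j\ne i$, and arbitrary $x_i(0)$, $\rho_i(0)$, the stacked output $Y=\operatorname{col}(y_1,\dots,y_N)$ converges exponentially to $\bar Y=\mathbf{1}_N\otimes y^*$, where $y^*$ is the optimal solution of $\min_{y\in\mathbb{R}^q}\sum_{i=1}^N f_i(y)$; here $\bar Y$ is the optimal solution of $$\min_{Y\in\mathbb{R}^{qN}}\ \sum_{i=1}^N f_i(y_i)\quad\text{subject to}\quad(\mathcal{L}\otimes I_q)Y=\mathbf{0}.$$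
   Context: Digraph conventions: $\mathcal{G}=(\mathcal{V},\mathcal{E},\mathcal{A})$ has node set $\mathcal{V}=\{1,\dots,N\}$, edge set $\mathcal{E}\subseteq\mathcal{V}\times\mathcal{V}$ and weighted adjacency matrix $\mathcal{A}=[a_{ij}]$, with $a_{ij}>0$ if $(j,i)\in\mathcal{E}$ (agent $i$ receives information from agent $j$), $a_{ij}=0$ otherwise, and $a_{ii}=0$. The Laplacian $\mathcal{L}=[l_{ij}]$ is $l_{ii}=\sum_{j=1}^N a_{ij}$, $l_{ij}=-a_{ij}$ for $i\ne j$. $\mathcal{G}$ is strongly connected if there is a directed path from every node to every other node; it is weight-balanced iff $\mathbf{1}_N^{\mathrm T}\mathcal{L}=\mathbf{0}_N^{\mathrm T}$. A continuously differentiable $f:\mathbb{R}^q\to\mathbb{R}$ is strongly convex with constant $m>0$ if $(x-y)^{\mathrm T}(\nabla f(x)-\nabla f(y))\ge m\|x-y\|^2$ for all $x,y$. A map $g:\mathbb{R}^q\to\mathbb{R}^q$ is globally Lipschitz with constant $M>0$ if $\|g(x)-g(y)\|\le M\|x-y\|$ for all $x,y$. $\operatorname{col}(\cdot)$ denotes stacking into a column vector; $\mathbf{1}_N$ is the all-ones vector in $\mathbb{R}^N$; $\otimes$ is the Kronecker product; $\|\cdot\|$ is the Euclidean norm. A matrix is Hurwitz if all its eigenvalues have negative real part. Under (3) the linear matrix equations have a solution $(\Upsilon_i,\Phi_i,\Psi_i)$ with $\Upsilon_i,\Phi_i\in\mathbb{R}^{p_i\times q}$, $\Psi_i\in\mathbb{R}^{n_i\times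 q}$; under (2) and the stated initialization $z_i^i(t)>0$ for all $t\ge0$, so the controller is well defined; under (1) $y^*$ exists and is unique. Exponential convergence of $Y$ to $\bar Y$ means that along each closed-loop trajectory there are constants $c\ge 0$, $\alpha>0$ with $\|Y(t)-\bar Y\|\le c\,e^{-\alpha t}$ for all $t\ge0$. *)

(* Defs.v *)
From HB Require Import structures.
From mathcomp Require Import all_boot all_order all_algebra.
From mathcomp Require Import all_classical all_reals all_analysis.
From mathcomp.real_closed Require Import complex mxtens.
Set Implicit Arguments.
Unset Strict Implicit.
Unset Printing Implicit Defensive.
Import Order.TTheory GRing.Theory Num.Theory.
Import numFieldNormedType.Exports.
Local Open Scope classical_set_scope.
Local Open Scope ring_scope.

(* The library norm on matrices is the sup norm, hence a separate Euclidean
   norm; both induce the same topology and the same derivatives. *)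
Definition enorm (R : realType) (k : nat) (x : 'cV[R]_k) : R :=
  Num.sqrt (\sum_(i < k) x i 0 ^+ 2).

Definition grad (R : realType) (q : nat) (f : 'cV[R]_q -> R) (x : 'cV[R]_q) :
    'cV[R]_q :=
  \col_(j < q) 'D_(delta_mx j 0) f x.

Definition continuously_differentiable (R : realType) (q : nat)
    (f : 'cV[R]_q -> R) : Prop :=
  (forall x, differentiable f x) /\ continuous (grad f).

Definition strongly_convex (R : realType) (q : nat) (m : R)
    (f : 'cV[R]_q -> R) : Prop :=
  forall x y,
    m * enorm (x - y) ^+ 2 <= ((x - y)^T *m (grad f x - grad f y)) 0 0.

Definition globally_lipschitz (R : realType) (q : nat) (M : R)
    (g : 'cV[R]_q -> 'cV[R]_q) : Prop :=
  forall x y, enorm (g x - g y) <= M * enorm (x - y).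

Definition optimal_solution (R : realType) (T : Type) (D : set T) (g : T -> R)
    (x : T) : Prop :=
  D x /\ forall y, D y -> g x <= g y.

Definition hurwitz (R : realType) (n : nat) (A : 'M[R]_n) : Prop :=
  forall l : complex R,
    eigenvalue (map_mx (real_complex R) A) l -> complex.Re l < 0.

Definition stabilizable (R : realType) (n p : nat) (A : 'M[R]_n)
    (B : 'M[R]_(n, p)) : Prop :=
  exists K : 'M[R]_(p, n), hurwitz (A - B *m K).

(* [E j i] is the edge (j, i): agent i receives information from agent j. *)
Definition adjacency_of (R : realType) (N : nat) (E : rel 'I_N)
    (a : 'M[R]_N) : Prop :=
  [/\ forall i j, E j i -> 0 < a i j,
      forall i j, ~~ E j i -> a i j = 0
    & forall i, a i i = 0].

Definition strongly_connected (N : nat) (E : rel 'I_N) : Prop :=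
  forall i j, connect E i j.

Definition laplacian (R : realType) (N : nat) (a : 'M[R]_N) : 'M[R]_N :=
  \matrix_(i, j) (if i == j then \sum_k a i k else - a i j).

(* Vectors of R^(qN) are indexed as in the Kronecker product [*t]: component k
   of block i sits at position i * q + k. *)
Definition stack (R : realType) (N q : nat) (y : 'I_N -> 'cV[R]_q) :
    'cV[R]_(N * q) :=
  \col_k y (mxtens_unindex k).1 (mxtens_unindex k).2 0.

Definition block (R : realType) (N q : nat) (Y : 'cV[R]_(N * q)) (i : 'I_N) :
    'cV[R]_q :=
  \col_k Y (mxtens_index (i, k)) 0.

Definition ones_tens (R : realType) (N q : nat) (y : 'cV[R]_q) :
    'cV[R]_(N * q) :=
  (const_mx 1 : 'cV[R]_N) *t y.

(* Trajectory of dx/dt = rhs on [0, +oo[; for a right-hand side that is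
   continuous along x, continuity at 0 yields the one-sided derivative there. *)
Definition solves (R : realType) (k : nat) (x rhs : R -> 'cV[R]_k) : Prop :=
  {within `[0, +oo[, continuous x} /\
  forall t : R, 0 < t -> is_derive t 1 x (rhs t).

Section ClosedLoop.
Context (R : realType) (N q : nat) (n p : 'I_N -> nat).
Variables (A : forall i, 'M[R]_(n i)) (B : forall i, 'M[R]_(n i, p i))
  (C : forall i, 'M[R]_(q, n i)) (K : forall i, 'M[R]_(p i, n i))
  (Ups Phi : forall i, 'M[R]_(p i, q)) (Psi : forall i, 'M[R]_(n i, q))
  (f : 'I_N -> 'cV[R]_q -> R) (a : 'M[R]_N) (gamma1 gamma2 : R)
  (x : forall i, R -> 'cV[R]_(n i)) (rho v : 'I_N -> R -> 'cV[R]_q)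
  (z : 'I_N -> R -> 'cV[R]_N).

Definition output (i : 'I_N) (t : R) : 'cV[R]_q := C i *m x i t.

Definition disagreement (i : 'I_N) (t : R) : 'cV[R]_q :=
  \sum_j a i j *: (output i t - output j t).

Definition omega (i : 'I_N) (t : R) : 'cV[R]_q :=
  - ((z i t i 0)^-1 *: grad (f i) (output i t))
  - gamma1 *: disagreement i t - gamma2 *: v i t.

Definition control (i : 'I_N) (t : R) : 'cV[R]_(p i) :=
  - (K i *m x i t) + Ups i *m omega i t
  - (Phi i - K i *m Psi i) *m rho i t.

Definition closed_loop_trajectory : Prop :=
  forall i,
    [/\ solves (x i) (fun t => A i *m x i t + B i *m control i t),
        solves (rho i) (omega i),
        solves (v i) (fun t => gamma1 *: disagreement i t),
        solves (z i) (fun t => - \sum_j a i j *: (z i t - z j t))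
      & v i 0 = 0 /\ z i 0 = delta_mx i 0].

End ClosedLoop.

Definition converges_exponentially (R : realType) (k : nat)
    (Y : R -> 'cV[R]_k) (Ybar : 'cV[R]_k) : Prop :=
  exists c alpha : R, [/\ 0 <= c, 0 < alpha
    & forall t, 0 <= t -> enorm (Y t - Ybar) <= c * expR (- alpha * t)].

(* Main.v *)
From HB Require Import structures.
Require Import Defs.
From mathcomp Require Import all_boot all_order all_algebra.
From mathcomp Require Import all_classical all_reals all_analysis.
From mathcomp.real_closed Require Import complex mxtens.
From mathcomp Require Import ring lra.
Import Order.TTheory GRing.Theory Num.Theory.
Import numFieldNormedType.Exports.
Local Open Scope ring_scope.

(** The proof is a Lyapunov argument in coordinates that separate each agent
    into a fast stable part and an integrator.

    Put [xb_i = x_i - Psi_i rho_i].  The three matrix equations turn the closed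
    loop into [xb_i' = (A_i - B_i K_i) xb_i], so [xb_i] dies out exponentially
    whatever the rest of the network does ([hurwitz_decays]), and, because
    [C_i Psi_i = 1], into [y_i' = omega_i + d_i] with [d_i] linear in [xb_i]
    ([is_derive_output]).  Up to an exponentially small disturbance, the outputs
    therefore follow a saddle-type consensus flow.

    The digraph is not weight-balanced, but its Laplacian has a positive left
    null vector [r] ([balancing_exists]).  In the weights [r], the
    disagreement term dissipates the energy [sum r_i a_ij (y_i - y_j)^2], which
    controls every difference [y_i - y_j] ([energy_gap]).  The estimators [z_i]
    run a consensus protocol that preserves the [r]-mean, hence [z_i^i] tends to
    [r_i] exponentially ([weight_estimate_decays]): dividing the gradient by
    [z_i^i] cancels the weight [r_i] in the limit, which is what makes the
    rest point satisfy [sum grad f_i (y) = 0] and not its [r]-weighted variant.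
    That equation has a solution [ystar], as the zero of a strongly monotone
    Lipschitz map, and strong convexity makes it the strict minimum of the sum.

    With [yt = y - ystar] and [vt_i = v_i + grad f_i (ystar) / (gamma2 r_i)], the
    sum [eta = yt + vt] no longer sees the disagreement term, which enters [yt']
    and [vt'] with opposite signs.  The Lyapunov function
    [V = sum r_i (|yt_i|^2 + |eta_i|^2)] then satisfies [V' <= - (m/3) V + g] with
    [g] exponentially small: strong convexity bounds [yt], a large [gamma2] makes
    the term in [|vt|^2] absorb the gradient, and the only indefinite term left,
    [gamma2 sum r_i yt_i vt_i], sees [yt] only through its differences since
    [sum r_i vt_i = 0]; a large [gamma1] absorbs it ([lyapunov_ineq]). *)

Set Implicit Arguments.
Unset Strict Implicit.
Unset Printing Implicit Defensive.

(** * Derivatives of vector-valued trajectories *)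

Lemma is_derive_sum_fun (R : realType) (I : finType) (P : pred I)
    (F : I -> R -> R) (dF : I -> R) (t : R) :
  (forall i, P i -> is_derive t 1 (F i) (dF i)) ->
  is_derive t 1 (fun s => \sum_(i | P i) F i s) (\sum_(i | P i) dF i).
Proof.
move=> h; elim: (index_enum I) => [|i s IH].
  by under eq_fun do rewrite big_nil; rewrite big_nil; exact: is_derive_cst.
under eq_fun do rewrite big_cons; rewrite big_cons.
by case: ifP => // Pi; apply: is_deriveD => //; exact: h.
Qed.

Lemma is_derive_mxP (R : realType) (m n : nat) (M : R -> 'M[R]_(m, n))
    (t : R) (D : 'M[R]_(m, n)) :
  is_derive t 1 M D <-> forall i j, is_derive t 1 (fun s => M s i j) (D i j).
Proof.
split=> [[dM <-] i j|h].
  rewrite derive_mx // mxE; apply: derivableP.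
  by move: dM => /derivable_mxP; exact.
have dM : derivable M t 1 by apply/derivable_mxP => i j; case: (h i j).
split=> //; rewrite derive_mx //; apply/matrixP => i j; rewrite mxE.
by case: (h i j).
Qed.

(** * Exponential decay *)

(** The bound is only asked for large times: a trajectory is differentiable on
    the open half-line only, and the estimates of the weights are usable only
    once they are close to their limits. *)
Definition decays (R : realType) (g : R -> R) : Prop :=
  exists c al : R, [/\ 0 <= c, 0 < al
    & \forall t \near +oo, `|g t| <= c * expR (- al * t)].

Lemma decays_le (R : realType) (g h : R -> R) :
  decays g -> (\forall t \near +oo, `|h t| <= `|g t|) -> decays h.
Proof.
move=> [c [al [c0 al0 gt]]] hg; exists c, al; split=> //.
by near=> t; apply: (@le_trans _ _ `|g t|); near: t.
Unshelve. all: by end_near. Qed.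

Lemma decays0 (R : realType) : decays (fun _ : R => 0).
Proof.
by exists 0, 1; split=> //; near=> t; rewrite normr0 mul0r.
Unshelve. all: by end_near. Qed.

Lemma decaysD (R : realType) (g h : R -> R) :
  decays g -> decays h -> decays (fun t => g t + h t).
Proof.
move=> [c [al [c0 al0 gt]]] [d [be [d0 be0 ht]]].
exists (c + d), (Num.min al be); split.
- exact: addr_ge0.
- by rewrite lt_min al0.
near=> t.
have t0 : 0 <= t by near: t; apply: nbhs_pinfty_ge; exact: num_real.
apply: (le_trans (ler_normD _ _)); rewrite mulrDl; apply: lerD.
  apply: (@le_trans _ _ (c * expR (- al * t))); first by near: t.
  by rewrite ler_wpM2l// ler_expR ler_wpM2r// lerN2 ge_min lexx.
apply: (@le_trans _ _ (d * expR (- be * t))); first by near: t.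
by rewrite ler_wpM2l// ler_expR ler_wpM2r// lerN2 ge_min lexx orbT.
Unshelve. all: by end_near. Qed.

Lemma decaysZ (R : realType) (k : R) (g : R -> R) :
  decays g -> decays (fun t => k * g t).
Proof.
move=> [c [al [c0 al0 gt]]]; exists (`|k| * c), al; split=> //.
  exact: mulr_ge0.
near=> t; rewrite normrM -mulrA ler_wpM2l//.
by near: t.
Unshelve. all: by end_near. Qed.

Lemma decays_sum (R : realType) (I : finType) (F : I -> R -> R) :
  (forall i, decays (F i)) -> decays (fun t => \sum_i F i t).
Proof.
move=> h; elim: (index_enum I) => [|i s IH].
  by under eq_fun do rewrite big_nil; exact: decays0.
by under eq_fun do rewrite big_cons; exact: decaysD.
Qed.

Lemma decays_small (R : realType) (g : R -> R) (e : R) :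
  decays g -> 0 < e -> \forall t \near +oo, `|g t| <= e.
Proof.
move=> [c [al [c0 al0 gt]]] e0.
near=> t.
apply: (@le_trans _ _ (c * expR (- al * t))); first by near: t.
(* [expR s >= s], used at [s = al * t >= c / e] *)
have ct : c / e <= al * t.
  by rewrite [leRHS]mulrC -ler_pdivrMr//; near: t;
    apply: nbhs_pinfty_ge; exact: num_real.
rewrite mulNr expRN ler_pdivrMr ?expR_gt0//.
apply: (@le_trans _ _ (e * (al * t))).
  by rewrite [leRHS]mulrC -ler_pdivrMr.
rewrite ler_pM2l//; apply: le_trans (expR_ge1Dx _); lra.
Unshelve. all: by end_near. Qed.

(** Comparison principle.  If [g] decays at a rate [be] smaller than [c], then
    [expR (c t) V t - k / (c - be) expR ((c - be) t)] is eventually nonincreasing;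
    the rate of [g] is first lowered to at most [c / 2]. *)
Lemma decays_linear_ineq (R : realType) (V dV g : R -> R) (c : R) : 0 < c ->
  decays g ->
  (\forall t \near +oo, [/\ 0 <= V t, is_derive t 1 V (dV t)
                           & dV t <= - c * V t + g t]) ->
  decays V.
Proof.
move=> c0 [k [al [k0 al0 gk]]] Vt.
pose be := Num.min al (c / 2).
have be0 : 0 < be by rewrite lt_min al0 divr_gt0.
have bec : 0 < c - be by rewrite subr_gt0 gt_min; apply/orP; right; lra.
have beal : be <= al by rewrite ge_min lexx.
have [T [Treal HT]] : \forall t \near +oo, [/\ 0 <= V t, is_derive t 1 V (dV t),
   dV t <= - c * V t + g t, 0 <= t & `|g t| <= k * expR (- be * t)].
  near=> t.
  have t0 : 0 <= t by near: t; apply: nbhs_pinfty_ge; exact: num_real.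
  have [? ? ?] : [/\ 0 <= V t, is_derive t 1 V (dV t)
                           & dV t <= - c * V t + g t] by near: t.
  split=> //; apply: (@le_trans _ _ (k * expR (- al * t))); first by near: t.
  by rewrite ler_wpM2l// ler_expR ler_wpM2r// lerN2.
have expE t : expR ((c - be) * t) = expR (- be * t) * expR (c * t).
  by rewrite -expRD; congr expR; ring.
pose W t := expR (c * t) * V t - k / (c - be) * expR ((c - be) * t).
pose dW t := expR (c * t) * (c * V t + dV t) - k * expR ((c - be) * t).
have WD t : T < t -> is_derive t 1 W (dW t).
  move=> /HT [_ dVt _ _ _].
  have d1 (d : R) : is_derive t 1 (fun s => expR (d * s)) (d * expR (d * t)).
    have -> : (fun s => expR (d * s)) = expR \o (fun s => d * s) by [].
    apply: is_derive_eq.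
    by rewrite /GRing.scale /= mulr1 mulrC.
  have := d1 c; have := d1 (c - be); move=> e1 e2.
  rewrite /W /dW; apply: is_derive_eq.
  rewrite /GRing.scale /=; field; lra.
have W0 t : T < t -> dW t <= 0.
  move=> /HT [V0 _ h _ gt].
  rewrite /dW expE mulrA subr_le0.
  rewrite mulrC ler_pM2r ?expR_gt0//.
  have := ler_norm (g t); lra.
pose T1 := T + 1.
have TT1 : T < T1 by rewrite /T1; lra.
have Wle t : T1 <= t -> W t <= W T1.
  move=> T1t.
  have [||s sI e] := @MVT_segment _ W dW _ _ T1t.
  - by move=> s; rewrite in_itv /= => /andP[s1 _]; apply: WD; exact: lt_trans s1.
  - apply: derivable_within_continuous => s; rewrite in_itv/= => /andP[s1 _].
    by have [] := WD s (lt_le_trans TT1 s1).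
  rewrite -subr_le0 e mulr_le0_ge0 ?subr_ge0//; apply: W0.
  by move: sI; rewrite in_itv/= => /andP[s1 _]; exact: lt_le_trans s1.
exists (`|W T1| + k / (c - be)), be; split=> //.
  by rewrite addr_ge0// divr_ge0// ltW.
near=> t.
have T1t : T1 <= t by near: t; apply: nbhs_pinfty_ge; exact: num_real.
have [V0 _ _ t0 _] := HT _ (lt_le_trans TT1 T1t).
rewrite ger0_norm//.
have := le_trans (Wle t T1t) (ler_norm _).
rewrite /W expE => h.
rewrite -(ler_pM2l (expR_gt0 (c * t))).
have e1 : 1 <= expR (c * t) * expR (- be * t).
  by rewrite -expRD -mulrDl -expR0 ler_expR mulr_ge0// ltW.
have : `|W T1| <= `|W T1| * (expR (c * t) * expR (- be * t)).
  by rewrite ler_peMr.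
rewrite mulrDl mulrDr; lra.
Unshelve. all: by end_near. Qed.

(** * Linear systems with a Hurwitz matrix *)

Lemma young_ineq (F : realFieldType) (c a b : F) :
  0 < c -> 2 * (a * b) <= c * a ^+ 2 + c^-1 * b ^+ 2.
Proof.
move=> c0; rewrite -subr_ge0.
suff -> : c * a ^+ 2 + c^-1 * b ^+ 2 - 2 * (a * b) = c^-1 * (c * a - b) ^+ 2.
  by rewrite mulr_ge0 ?invr_ge0 ?sqr_ge0// ltW.
by field; lra.
Qed.

Lemma is_derive_mulmx (R : realType) (m n k : nat) (Q : 'M[R]_(m, n))
    (x : R -> 'M[R]_(n, k)) (dx : 'M[R]_(n, k)) (t : R) :
  is_derive t 1 x dx -> is_derive t 1 (fun s => Q *m x s) (Q *m dx).
Proof.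
move=> /is_derive_mxP h; apply/is_derive_mxP => i j; rewrite mxE.
under eq_fun do rewrite mxE.
by apply: is_derive_sum_fun => l _; exact: is_deriveZ.
Qed.

(** The square of [enorm]: a polynomial in the entries, hence differentiable. *)
Definition sqn (R : realType) (n : nat) (x : 'cV[R]_n) : R :=
  \sum_i x i 0 ^+ 2.

Lemma sqn_ge0 (R : realType) (n : nat) (x : 'cV[R]_n) : 0 <= sqn x.
Proof. by apply: sumr_ge0 => i _; exact: sqr_ge0. Qed.

Lemma is_derive_sqn (R : realType) (n : nat) (x : R -> 'cV[R]_n)
    (dx : 'cV[R]_n) (t : R) :
  is_derive t 1 x dx ->
  is_derive t 1 (fun s => sqn (x s)) (\sum_i 2 * (x t i 0 * dx i 0)).
Proof.
move=> /is_derive_mxP h; apply: is_derive_sum_fun => i _.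
have := h i 0 => hi; apply: is_derive_eq.
by rewrite /GRing.scale /=; ring.
Qed.

Lemma map_Re_mulmx (R : realType) (m n k : nat) (Q : 'M[complex R]_(m, n))
    (M : 'M[R]_(n, k)) :
  map_mx (@complex.Re R) (Q *m map_mx (real_complex R) M) =
  map_mx (@complex.Re R) Q *m M.
Proof.
apply/matrixP => i j; rewrite !mxE raddf_sum; apply: eq_bigr => l _.
by rewrite !mxE; case: (Q i l) => a b /=; rewrite mulr0 subr0.
Qed.

Lemma map_Im_mulmx (R : realType) (m n k : nat) (Q : 'M[complex R]_(m, n))
    (M : 'M[R]_(n, k)) :
  map_mx (@complex.Im R) (Q *m map_mx (real_complex R) M) =
  map_mx (@complex.Im R) Q *m M.
Proof.
apply/matrixP => i j; rewrite !mxE raddf_sum; apply: eq_bigr => l _.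
by rewrite !mxE; case: (Q i l) => a b /=; rewrite mulr0 add0r.
Qed.

(** Peeling off one eigenvalue at a time avoids matrix exponentials and Jordan
    forms.  If [P1 = P (H - l)], then [p = P x] satisfies [p' = l p + P1 x], a
    scalar equation in each component, driven by a term that decays by
    induction; its squared modulus decays since [Re l < 0].  The matrix [P] is
    complex and [x] is real, so the real and imaginary parts of [P x] are
    carried separately. *)
Lemma decays_annihilated (R : realType) (n : nat) (H : 'M[R]_n)
    (x : R -> 'cV[R]_n) (s : seq (complex R)) (P : 'M[complex R]_n) :
  (forall t : R, 0 < t -> is_derive t 1 x (H *m x t)) ->
  (forall l, l \in s -> complex.Re l < 0) ->
  foldl (fun Q l => Q *m (map_mx (real_complex R) H - l%:M)) P s = 0 ->
  decays (fun t => sqn (map_mx (@complex.Re R) P *m x t) +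
                   sqn (map_mx (@complex.Im R) P *m x t)).
Proof.
move=> dx; elim: s P => [|l s IH] P.
  move=> _ /= ->; apply: decays_le (decays0 R) _; near=> t.
  have -> : map_mx (@complex.Re R) (0 : 'M[complex R]_n) = 0.
    by apply/matrixP => i j; rewrite !mxE.
  have -> : map_mx (@complex.Im R) (0 : 'M[complex R]_n) = 0.
    by apply/matrixP => i j; rewrite !mxE.
  rewrite mul0mx /sqn !big1 ?addr0 ?normr0//.
  by move=> i _; rewrite mxE expr0n.
move=> ls /= P0; set P1 := P *m _ in P0.
have {}IH : decays _ :=
  IH P1 (fun l0 h => ls l0 (@mem_behead _ (l :: s) l0 h)) P0.
have l0 : complex.Re l < 0 by apply: ls; rewrite mem_head.
have PH : P *m map_mx (real_complex R) H = P1 + l *: P.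
  by rewrite /P1 mulmxBr mul_mx_scalar subrK.
clearbody P1.
set c := - complex.Re l.
have c0 : 0 < c by rewrite /c; lra.
pose u t := map_mx (@complex.Re R) P *m x t.
pose w t := map_mx (@complex.Im R) P *m x t.
pose u1 t := map_mx (@complex.Re R) P1 *m x t.
pose w1 t := map_mx (@complex.Im R) P1 *m x t.
have du (t : R) : 0 < t ->
    is_derive t 1 u (- c *: u t - complex.Im l *: w t + u1 t).
  move=> t0; have := is_derive_mulmx (map_mx (@complex.Re R) P) (dx t t0).
  rewrite mulmxA -map_Re_mulmx PH => h; apply: (is_derive_eq h).
  rewrite /u /w /u1 !scalemxAl -mulmxBl -mulmxDl; congr (_ *m _).
  apply/matrixP => i j; rewrite !mxE.
  rewrite /c; case: (P i j) => ? ?; case: (P1 i j) => ? ?; case: (l) => ? ? /=.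
  by ring.
have dw (t : R) : 0 < t ->
    is_derive t 1 w (- c *: w t + complex.Im l *: u t + w1 t).
  move=> t0; have := is_derive_mulmx (map_mx (@complex.Im R) P) (dx t t0).
  rewrite mulmxA -map_Im_mulmx PH => h; apply: (is_derive_eq h).
  rewrite /u /w /w1 !scalemxAl -!mulmxDl; congr (_ *m _).
  apply/matrixP => i j; rewrite !mxE.
  rewrite /c; case: (P i j) => ? ?; case: (P1 i j) => ? ?; case: (l) => ? ? /=.
  by ring.
apply: (@decays_linear_ineq R (fun t => sqn (u t) + sqn (w t))
  (fun t =>
     \sum_i 2 * (u t i 0 * (- c *: u t - complex.Im l *: w t + u1 t) i 0) +
     \sum_i 2 * (w t i 0 * (- c *: w t + complex.Im l *: u t + w1 t) i 0))
  (fun t => c^-1 * (sqn (u1 t) + sqn (w1 t))) c c0 (decaysZ c^-1 IH)).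
near=> t; have t0 : 0 < t by near: t; apply: nbhs_pinfty_gt; exact: num_real.
split; first by rewrite addr_ge0 ?sqn_ge0.
  by apply: is_deriveD; apply: is_derive_sqn; [exact: du | exact: dw].
move: (u t) (w t) (u1 t) (w1 t) => U W U1 W1.
rewrite /sqn -!big_split /= !mulr_sumr.
rewrite -big_split /=; apply: ler_sum => i _; rewrite !mxE.
have := young_ineq (U i 0) (U1 i 0) c0.
have := young_ineq (W i 0) (W1 i 0) c0.
by lra.
Unshelve. all: by end_near. Qed.

Lemma foldl_mulmx_factors (F : fieldType) (n : nat) (A P : 'M[F]_n.+1)
    (s : seq F) :
  foldl (fun Q l => Q *m (A - l%:M)) P s =
  P *m horner_mx A (\prod_(l <- s) ('X - l%:P)).
Proof.
elim: s P => [|l s IH] P /=; first by rewrite big_nil rmorph1 mulmx1.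
rewrite IH big_cons rmorphM rmorphB /= horner_mx_X horner_mx_C.
by rewrite -mulmxA.
Qed.

(** The characteristic polynomial splits over the complex numbers, and by
    Cayley-Hamilton the product of its factors at [H] annihilates the identity. *)
Lemma hurwitz_decays (R : realType) (n : nat) (H : 'M[R]_n)
    (x : R -> 'cV[R]_n) :
  hurwitz H -> (forall t : R, 0 < t -> is_derive t 1 x (H *m x t)) ->
  decays (fun t => sqn (x t)).
Proof.
case: n H x => [|n] H x hH dx.
  by under eq_fun do rewrite /sqn big_ord0; exact: decays0.
have [s Es] := closed_field_poly_normal (char_poly (map_mx (real_complex R) H)).
have chm := char_poly_monic (map_mx (real_complex R) H).
rewrite (monicP chm) scale1r in Es.
have := @decays_annihilated R n.+1 H x s 1%:M dx.
rewrite foldl_mulmx_factors -Es mul1mx.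
have -> : map_mx (@complex.Re R) 1%:M = 1%:M :> 'M[R]_n.+1.
  by apply/matrixP => i j; rewrite !mxE; case: (i == j).
have -> : map_mx (@complex.Im R) 1%:M = 0 :> 'M[R]_n.+1.
  by apply/matrixP => i j; rewrite !mxE; case: (i == j).
move=> h; apply: decays_le (h _ _) _ => [l ls||].
- by apply: hH; rewrite eigenvalue_root_char Es root_prod_XsubC.
- exact: Cayley_Hamilton.
- near=> t; rewrite mul1mx mul0mx [sqn 0]big1 ?addr0// => i _.
  by rewrite mxE expr0n.
Unshelve. all: by end_near. Qed.

(** * Balancing weights of a strongly connected digraph *)

(** The third clause says that [r] is a left null vector of the Laplacian. *)
Definition balancing (R : realType) (N : nat) (a : 'M[R]_N) (r : 'I_N -> R) :
    Prop :=
  [/\ forall i, 0 < r i, \sum_i r i = 1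
    & forall j, \sum_i r i * a i j = r j * \sum_k a j k].

(** The Dirichlet form of the digraph for the edge weights [r i * a i j], which
    are balanced although [a] is not. *)
Definition energy (R : realType) (N : nat) (a : 'M[R]_N) (r y : 'I_N -> R) : R :=
  \sum_i \sum_j r i * a i j * (y i - y j) ^+ 2.

Lemma connect_ind (N : nat) (E : rel 'I_N) (P : 'I_N -> Prop) (i j : 'I_N) :
  (forall k l, E k l -> P k -> P l) -> connect E i j -> P i -> P j.
Proof.
move=> EP /connectP[p Ep ->]; elim: p i Ep => [|k p IH] i //= /andP[Eik Ep] Pi.
exact: IH Ep (EP _ _ Eik Pi).
Qed.

Lemma adjacency_ge0 (R : realType) (N : nat) (E : rel 'I_N) (a : 'M[R]_N) i j :
  adjacency_of E a -> 0 <= a i j.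
Proof.
move=> [aE anE _]; case: (boolP (E j i)) => [/aE/ltW//|/anE ->]; exact: lexx.
Qed.

Lemma mulmx_laplacianE (R : realType) (N : nat) (E : rel 'I_N) (a : 'M[R]_N)
    (u : 'rV[R]_N) (j : 'I_N) : adjacency_of E a ->
  (u *m laplacian a) 0 j = u 0 j * (\sum_k a j k) - \sum_i u 0 i * a i j.
Proof.
move=> [_ _ a0]; rewrite !mxE (bigD1 j)//= !mxE eqxx.
rewrite [X in _ = _ - X](bigD1 j) //= a0 mulr0 add0r -sumrN; congr (_ + _).
by apply: eq_bigr => i /negbTE ij; rewrite !mxE ij mulrN.
Qed.

Lemma laplacian_mulmxE (R : realType) (N : nat) (E : rel 'I_N) (a : 'M[R]_N)
    (y : 'cV[R]_N) (i : 'I_N) : adjacency_of E a ->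
  (laplacian a *m y) i 0 = \sum_j a i j * (y i 0 - y j 0).
Proof.
move=> [_ _ a0]; rewrite mxE (bigD1 i)//= [in RHS](bigD1 i)//= !mxE.
rewrite eqxx a0 mul0r add0r.
rewrite [X in X * _](bigD1 i) //= a0 add0r mulr_suml -big_split /=.
apply: eq_bigr => j ji; rewrite !mxE eq_sym (negbTE ji); ring.
Qed.

(** The Laplacian is singular because it kills constants; let [u] be a left null
    vector.  Then [|u|] is one too, and a zero entry of a nonnegative left null
    vector would spread along every edge, hence everywhere. *)
Lemma balancing_exists (R : realType) (N : nat) (E : rel 'I_N) (a : 'M[R]_N) :
  (0 < N)%N -> adjacency_of E a -> strongly_connected E ->
  exists r, balancing a r.
Proof.
move=> N0 aE sc.
have a_ge0 i j := adjacency_ge0 i j aE.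
have : \det (laplacian a) = 0.
  rewrite -det_tr; apply/eqP/det0P; exists (const_mx 1).
    apply/eqP => /rowP /(_ (Ordinal N0)); rewrite !mxE => /eqP.
    by rewrite oner_eq0.
  apply: trmx_inj; rewrite trmx_mul trmxK; apply/colP => i.
  rewrite (laplacian_mulmxE _ _ aE) big1 ?mxE// => j _.
  by rewrite !mxE subrr mulr0.
move=> /eqP/det0P[u u0 uL].
have ub j : u 0 j * (\sum_k a j k) = \sum_i u 0 i * a i j.
  by apply/eqP; rewrite -subr_eq0 -(mulmx_laplacianE _ _ aE) uL mxE.
(* The triangle inequality gives one inequality in each column; summed over the
   columns, both sides agree, so every one of them is an equality. *)
have nle j : `|u 0 j| * (\sum_k a j k) <= \sum_i `|u 0 i| * a i j.
  have da : 0 <= \sum_k a j k by apply: sumr_ge0.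
  rewrite -[X in _ * X]ger0_norm// -normrM ub (le_trans (ler_norm_sum _ _ _))//.
  by apply: ler_sum => i _; rewrite normrM [`|a i j|]ger0_norm.
have nE j : `|u 0 j| * (\sum_k a j k) = \sum_i `|u 0 i| * a i j.
  have tot : \sum_j (\sum_i `|u 0 i| * a i j - `|u 0 j| * (\sum_k a j k)) = 0.
    rewrite sumrB exchange_big /= -sumrB big1// => i _.
    by rewrite mulr_sumr subrr.
  apply/eqP; rewrite eq_sym -subr_eq0; apply/eqP.
  by apply: (psumr_eq0P _ tot) => // i _; rewrite subr_ge0.
have upos j : 0 < `|u 0 j|.
  rewrite normr_gt0; apply/eqP => uj0; move/eqP: u0; apply.
  apply/rowP => i; rewrite mxE.
  apply: (@connect_ind N E (fun k => u 0 k = 0) j i) => // k l Ekl uk0.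
  have := nE k; rewrite uk0 normr0 mul0r => /esym.
  move=> /(psumr_eq0P (fun i _ => mulr_ge0 (normr_ge0 _) (a_ge0 i k))) /(_ l isT).
  move=> /eqP; rewrite mulf_eq0 normr_eq0 => /orP[/eqP//|/eqP alk].
  by have [/(_ _ _ Ekl)] := aE; rewrite alk ltxx.
pose s := \sum_i `|u 0 i|.
have s0 : 0 < s.
  rewrite /s (bigD1 (Ordinal N0))//= ltr_pwDl//; exact: sumr_ge0.
exists (fun i => `|u 0 i| / s); split=> [i||j].
- exact: divr_gt0.
- by rewrite -mulr_suml divff// gt_eqF.
- rewrite mulrAC nE mulr_suml; apply: eq_bigr => i _; ring.
Qed.

Section Energy.
Context (R : realType) (N : nat) (a : 'M[R]_N) (r : 'I_N -> R).
Hypothesis ra : balancing a r.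

(** Balance: for the edge weights [r i * a i j], in-flow equals out-flow at each
    node. *)
Lemma balanced_exchange (g : 'I_N -> R) :
  \sum_i \sum_j r i * a i j * g j = \sum_i \sum_j r i * a i j * g i.
Proof.
have [_ _ bal] := ra.
rewrite exchange_big /=; apply: eq_bigr => j _.
by rewrite -mulr_suml bal mulr_sumr mulr_suml.
Qed.

Lemma balanced_conserved (y : 'I_N -> R) :
  \sum_i r i * \sum_j a i j * (y i - y j) = 0.
Proof.
transitivity (\sum_i \sum_j r i * a i j * y i - \sum_i \sum_j r i * a i j * y j).
  rewrite -sumrB; apply: eq_bigr => i _; rewrite mulr_sumr -sumrB.
  by apply: eq_bigr => j _; ring.
by rewrite balanced_exchange subrr.
Qed.

(** For balanced weights the quadratic form of the nonsymmetric Laplacian is the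
    Dirichlet form: the square terms cancel by [balanced_exchange]. *)
Lemma energyE (y : 'I_N -> R) :
  energy a r y = 2 * \sum_i r i * (y i * \sum_j a i j * (y i - y j)).
Proof.
transitivity (\sum_i \sum_j r i * a i j * (2 * (y i * (y i - y j))) +
    (\sum_i \sum_j r i * a i j * y j ^+ 2 - \sum_i \sum_j r i * a i j * y i ^+ 2)).
  rewrite -sumrB -big_split /=; apply: eq_bigr => i _.
  rewrite -sumrB -big_split /=; apply: eq_bigr => j _; ring.
rewrite (balanced_exchange (fun i => y i ^+ 2)) subrr addr0 mulr_sumr.
apply: eq_bigr => i _; rewrite !mulr_sumr; apply: eq_bigr => j _; ring.
Qed.

(** Spectral gap.  A difference across an edge is a term of the energy, and
    differences add up along a path. *)
Lemma energy_gap (E : rel 'I_N) : adjacency_of E a -> strongly_connected E ->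
  exists2 c, 0 < c & forall i j y, (y i - y j) ^+ 2 <= c * energy a r y.
Proof.
move=> aE sc; have [r0 _ _] := ra.
have w0 i j : 0 <= r i * a i j.
  by rewrite mulr_ge0 ?(adjacency_ge0 _ _ aE)// ltW.
have energy0 y : 0 <= energy a r y.
  by apply: sumr_ge0 => i _; apply: sumr_ge0 => j _; rewrite mulr_ge0 ?sqr_ge0.
have edge k l y : E k l -> (y k - y l) ^+ 2 <= (r l * a l k)^-1 * energy a r y.
  move=> Ekl; have alk : 0 < a l k by have [/(_ _ _ Ekl)] := aE.
  rewrite mulrC ler_pdivlMr ?mulr_gt0// mulrC /energy.
  rewrite (bigD1 l)//= (bigD1 k)//= -[y k - y l]opprB sqrrN -addrA lerDl.
  rewrite addr_ge0//; first by apply: sumr_ge0 => j _; rewrite mulr_ge0 ?sqr_ge0.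
  apply: sumr_ge0 => i _; apply: sumr_ge0 => j _; by rewrite mulr_ge0 ?sqr_ge0.
have pair (ij : 'I_N * 'I_N) : exists c, 0 <= c /\
    forall y, (y ij.1 - y ij.2) ^+ 2 <= c * energy a r y.
  case: ij => i j /=.
  apply: (@connect_ind N E (fun k => exists c, 0 <= c /\
    forall y : 'I_N -> R, (y i - y k) ^+ 2 <= c * energy a r y) i j) => //.
  - move=> k l Ekl [c [c0 hc]]; exists (2 * c + 2 * (r l * a l k)^-1); split.
      by rewrite addr_ge0 ?mulr_ge0 ?invr_ge0.
    move=> y; have := hc y; have := edge k l y Ekl.
    have := sqr_ge0 ((y i - y k) - (y k - y l)).
    move: (_^-1) => d; nra.
  - by exists 0; split=> // y; rewrite subrr expr0n mul0r.
have [c hc] := choice pair.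
exists (1 + \sum_ij c ij) => [|i j y].
  by rewrite ltr_pwDl// sumr_ge0// => ij _; have [] := hc ij.
apply: (le_trans ((hc (i, j)).2 y)); rewrite ler_wpM2r//.
rewrite (bigD1 (i, j))//= addrCA lerDl addr_ge0//.
by apply: sumr_ge0 => ij _; have [] := hc ij.
Qed.

End Energy.

(** * Zeros of strongly monotone maps *)

Lemma enorm_sqr (R : realType) (n : nat) (x : 'cV[R]_n) : enorm x ^+ 2 = sqn x.
Proof. by rewrite /enorm sqr_sqrtr// sqn_ge0. Qed.

Lemma sqn_eq0 (R : realType) (n : nat) (x : 'cV[R]_n) : sqn x = 0 -> x = 0.
Proof.
move=> /psumr_eq0P x0; apply/colP => i; rewrite mxE.
by apply/eqP; rewrite -sqrf_eq0 x0// => j _; exact: sqr_ge0.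
Qed.

(** The fixed point theorem is applied in the sup norm, while the hypotheses are
    Euclidean; hence this comparison and the next one. *)
Lemma norm_sqr_le_sqn (R : realType) (n : nat) (x : 'cV[R]_n) :
  `|x| ^+ 2 <= sqn x.
Proof.
rewrite -(sqr_sqrtr (sqn_ge0 x)) ler_sqr ?nnegrE ?sqrtr_ge0//.
rewrite /Num.norm/= mx_normrE; apply: bigmax_le => [|[i j] _ /=].
  exact: sqrtr_ge0.
rewrite -ler_sqr ?nnegrE ?sqrtr_ge0// sqr_sqrtr ?sqn_ge0//.
rewrite real_normK ?num_real// (ord1 j) /sqn (bigD1 i)//= lerDl.
apply: sumr_ge0 => k _; exact: sqr_ge0.
Qed.

Lemma sqn_le_norm_sqr (R : realType) (n : nat) (x : 'cV[R]_n) :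
  sqn x <= n%:R * `|x| ^+ 2.
Proof.
have -> : n%:R * `|x| ^+ 2 = \sum_(i < n) `|x| ^+ 2.
  by rewrite sumr_const card_ord mulr_natl.
apply: ler_sum => i _.
rewrite -real_normK ?num_real// ler_sqr ?nnegrE//.
by rewrite [leRHS]/Num.norm/= mx_normrE; exact: (le_bigmax _ _ (i, 0)).
Qed.

(** Joins the complete uniform structure of column vectors with their norm. *)
HB.instance Definition _ (R : realType) (n : nat) := Complete.on 'cV[R]_n.

(** A gradient step [T] contracts the Euclidean norm by the factor [kap].  It need
    not contract the sup norm, but a large iterate of it does, whose fixed point
    is also fixed by [T]. *)
Lemma strongly_monotone_zero (R : realType) (q : nat) (G : 'cV[R]_q -> 'cV[R]_q)
    (m M : R) : 0 < m ->
  (forall x y, m * sqn (x - y) <=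
     \sum_k (x - y) k 0 * (G x - G y) k 0) ->
  (forall x y, sqn (G x - G y) <= M ^+ 2 * sqn (x - y)) ->
  exists y, G y = 0.
Proof.
move=> m0 mon lip.
pose S := m ^+ 2 + M ^+ 2.
have S0 : 0 < S by rewrite ltr_wpDr ?sqr_ge0 ?exprn_gt0.
pose T x := x - (m / S) *: G x.
pose kap := M ^+ 2 / S.
have kap0 : 0 <= kap by rewrite divr_ge0 ?sqr_ge0// ltW.
have kap1 : kap < 1 by rewrite ltr_pdivrMr// mul1r ltrDr exprn_gt0.
have Tc x y : sqn (T x - T y) <= kap * sqn (x - y).
  have -> : sqn (T x - T y) = sqn (x - y)
      - 2 * (m / S) * (\sum_k (x - y) k 0 * (G x - G y) k 0)
      + (m / S) ^+ 2 * sqn (G x - G y).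
    rewrite /sqn !mulr_sumr -sumrB -big_split /=; apply: eq_bigr => k _.
    by rewrite /T !mxE; ring.
  have mS : 0 < m / S by rewrite divr_gt0.
  have h1 := ler_wpM2l (ltW mS) (mon x y).
  have h2 := ler_wpM2l (sqr_ge0 (m / S)) (lip x y).
  have -> : kap * sqn (x - y) = sqn (x - y) - (m / S) * (m * sqn (x - y)).
    by rewrite /kap /S; field; rewrite gt_eqF.
  suff : (m / S) ^+ 2 * (M ^+ 2 * sqn (x - y)) <= (m / S) * (m * sqn (x - y)).
    by move: h1 h2; lra.
  rewrite [_ ^+ 2]expr2 -[_ * (m / S) * _]mulrA ler_pM2l// mulrA.
  rewrite ler_wpM2r ?sqn_ge0//.
  by rewrite mulrAC -mulrA ger_pMr// ltW.
have Tk k x y : sqn (iter k T x - iter k T y) <= kap ^+ k * sqn (x - y).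
  elim: k => [|k IH]; first by rewrite expr0 mul1r.
  rewrite !iterS exprS -mulrA (le_trans (Tc _ _))//.
  exact: ler_wpM2l.
(* [q] is the price of passing from the Euclidean to the sup norm and back. *)
have [k hk] : exists k, kap ^+ k * q%:R <= 4^-1.
  have h : ((fun k => kap ^+ k * q%:R) @ \oo --> (0 * q%:R : R))%classic.
    by apply: cvgMl; apply: cvg_expr; rewrite ger0_norm.
  rewrite mul0r in h.
  have /cvgrPdist_le /(_ 4^-1) := h; rewrite invr_gt0.
  move=> /(_ (ltr0Sn _ _)) [k _ hk].
  exists k; have := hk k (leqnn k); rewrite sub0r normrN /= ger0_norm//.
  by rewrite mulr_ge0// exprn_ge0.
pose f := iter k T.
have fun_f : set_fun [set: 'cV[R]_q]%classic [set: 'cV[R]_q]%classic f by [].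
pose F : {fun [set: 'cV[R]_q] >-> [set: 'cV[R]_q]} :=
  HB.pack f (isFun.Build _ _ _ _ f fun_f).
have ctr : is_contraction F.
  exists (NngNum (ltac:(lra) : 0 <= 2^-1 :> R)); split=> [|[x y] _] /=; first lra.
  rewrite -ler_sqr ?nnegrE ?mulr_ge0//.
  apply: (le_trans (norm_sqr_le_sqn _)); apply: (le_trans (Tk k x y)).
  apply: (@le_trans _ _ (kap ^+ k * (q%:R * `|x - y| ^+ 2))).
    by rewrite ler_wpM2l ?exprn_ge0// sqn_le_norm_sqr.
  rewrite mulrA [leRHS]exprMn ler_wpM2r ?sqr_ge0//; lra.
have [||y _ yF] := banach_fixed_point ctr; first exact: closedT.
  by exists 0.
have Ty : T y = y.
  apply/esym/(contraction_fixpoint_unique ctr) => //=.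
  by rewrite /f -iterSr iterS; congr T.
exists y; move/eqP: Ty; rewrite /T -subr_eq0 addrAC subrr add0r oppr_eq0.
by rewrite scaler_eq0 gt_eqF ?divr_gt0// => /eqP.
Qed.

Lemma is_derive_along_line (R : realType) (q : nat) (f : 'cV[R]_q -> R)
    (y d : 'cV[R]_q) (s : R) : differentiable f (y + s *: d) ->
  is_derive s 1 (fun s => f (y + s *: d))
    (\sum_k d k 0 * grad f (y + s *: d) k 0).
Proof.
move=> df; pose g := fun s : R => y + s *: d.
have dg : is_diff s g ( *:%R ^~ d).
  by rewrite /g; apply: is_diff_eq; apply/funext => h /=; rewrite add0r.
have dfg : differentiable (f \o g) s by apply: differentiable_comp.
have -> : \sum_k d k 0 * grad f (g s) k 0 = 'D_1 (f \o g) s.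
  have Dg : 'd g s 1 = d by rewrite diff_val scale1r.
  rewrite deriveE// diff_comp// [RHS]/comp [in RHS]Dg.
  have {2}-> : d = \sum_k d k 0 *: delta_mx k 0.
    by rewrite {1}(matrix_sum_delta d); apply: eq_bigr => k _; rewrite big_ord1.
  rewrite linear_sum; apply: eq_bigr => k _.
  by rewrite linearZ /= mxE deriveE.
by apply: derivableP; apply/derivable1_diffP.
Qed.

(** * The optimum, with and without the consensus constraint *)

Lemma strongly_convex_sqn (R : realType) (q : nat) (m : R)
    (f : 'cV[R]_q -> R) (x y : 'cV[R]_q) : strongly_convex m f ->
  m * sqn (x - y) <= \sum_k (x - y) k 0 * (grad f x - grad f y) k 0.
Proof.
move=> /(_ x y); rewrite enorm_sqr mxE => /le_trans; apply.
by apply: ler_sum => k _; rewrite [X in X * _ <= _]mxE.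
Qed.

Lemma globally_lipschitz_sqn (R : realType) (q : nat) (M : R)
    (g : 'cV[R]_q -> 'cV[R]_q) (x y : 'cV[R]_q) : globally_lipschitz M g ->
  sqn (g x - g y) <= M ^+ 2 * sqn (x - y).
Proof.
move=> /(_ x y) h; rewrite -!enorm_sqr -exprMn lerXn2r// ?nnegrE ?sqrtr_ge0//.
exact: le_trans (sqrtr_ge0 _) h.
Qed.

Lemma sqr_sum_le (R : realFieldType) (N : nat) (u : 'I_N -> R) :
  (\sum_i u i) ^+ 2 <= N%:R * \sum_i u i ^+ 2.
Proof.
have -> : N%:R * \sum_i u i ^+ 2 = \sum_i \sum_j (u i ^+ 2 + u j ^+ 2) / 2.
  transitivity (\sum_(i < N) \sum_(j < N) (u i ^+ 2 / 2) +
                \sum_(i < N) \sum_(j < N) (u j ^+ 2 / 2)).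
    rewrite [X in _ = _ + X]exchange_big /= -big_split /= mulr_sumr.
    by apply: eq_bigr => i _; rewrite sumr_const card_ord -mulr_natl; field.
  rewrite -big_split /=; apply: eq_bigr => i _.
  by rewrite -big_split /=; apply: eq_bigr => j _; field.
rewrite expr2 mulr_suml; apply: ler_sum => i _; rewrite mulr_sumr.
apply: ler_sum => j _; have := sqr_ge0 (u i - u j); lra.
Qed.

Section Optimum.
Context (R : realType) (N q : nat) (f : 'I_N -> 'cV[R]_q -> R) (m : 'I_N -> R).
Hypothesis N_gt0 : (0 < N)%N.
Hypothesis m_gt0 : forall i, 0 < m i.
Hypothesis f_convex : forall i, strongly_convex (m i) (f i).

Let i0 : 'I_N := Ordinal N_gt0.

Let sum_m_gt0 : 0 < \sum_i m i.
Proof. by rewrite (bigD1 i0)//= ltr_pwDl// sumr_ge0// => i _; exact: ltW. Qed.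

Lemma sum_grad_monotone (x y : 'cV[R]_q) :
  (\sum_i m i) * sqn (x - y) <=
    \sum_k (x - y) k 0 * (\sum_i grad (f i) x - \sum_i grad (f i) y) k 0.
Proof.
rewrite mulr_suml; under [leRHS]eq_bigr do rewrite -sumrB summxE mulr_sumr.
rewrite exchange_big; apply: ler_sum => i _; exact: strongly_convex_sqn.
Qed.

Lemma critical_point_exists (M : 'I_N -> R) :
  (forall i, globally_lipschitz (M i) (grad (f i))) ->
  exists y, \sum_i grad (f i) y = 0.
Proof.
move=> f_lip.
apply: (@strongly_monotone_zero _ _ _ (\sum_i m i)
          (Num.sqrt (N%:R * \sum_i M i ^+ 2)) sum_m_gt0 sum_grad_monotone) => x y.
rewrite sqr_sqrtr; last by rewrite mulr_ge0// sumr_ge0// => i _; exact: sqr_ge0.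
apply: (@le_trans _ _ (N%:R * \sum_i sqn (grad (f i) x - grad (f i) y))).
  rewrite /sqn exchange_big mulr_sumr; apply: ler_sum => k _.
  by rewrite -sumrB summxE sqr_sum_le.
rewrite -mulrA ler_wpM2l// mulr_suml; apply: ler_sum => i _.
exact: globally_lipschitz_sqn.
Qed.

(** Along the segment from [ystar] to [y], strong monotonicity makes the
    derivative of the objective positive; the mean value theorem concludes. *)
Lemma critical_point_minimum (ystar y : 'cV[R]_q) :
  (forall i x, differentiable (f i) x) ->
  \sum_i grad (f i) ystar = 0 -> y != ystar ->
  \sum_i f i ystar < \sum_i f i y.
Proof.
move=> df crit ny; set d := y - ystar.
pose phi (s : R) := \sum_i f i (ystar + s *: d).
pose dphi (s : R) := \sum_i \sum_k d k 0 * grad (f i) (ystar + s *: d) k 0.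
have phiD (s : R) : is_derive s 1 phi (dphi s).
  by apply: is_derive_sum_fun => i _; exact: is_derive_along_line.
have phi_cont : ({within `[0%R, 1%R], continuous phi})%classic.
  by apply: derivable_within_continuous => s _; have [] := phiD s.
have [c c01 e] := MVT ltr01 (fun s _ => phiD s) phi_cont.
have -> : \sum_i f i ystar = phi 0.
  by rewrite /phi scale0r addr0.
have -> : \sum_i f i y = phi 1.
  by rewrite /phi scale1r /d addrC subrK.
rewrite -subr_gt0 e subr0 mulr1.
move: c01; rewrite in_itv /= => /andP[c0 _].
rewrite -(pmulr_rgt0 _ c0).
have := sum_grad_monotone (ystar + c *: d) ystar.
rewrite crit subr0 [ystar + _]addrC addrK => h.
apply: (@lt_le_trans _ _ ((\sum_i m i) * sqn (c *: d))).
  rewrite mulr_gt0// lt_neqAle sqn_ge0 andbT eq_sym.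
  apply/eqP => /sqn_eq0/eqP; rewrite scaler_eq0 gt_eqF//= subr_eq0.
  exact/negP.
apply: (le_trans h); rewrite le_eqVlt; apply/orP; left; apply/eqP.
rewrite /dphi exchange_big mulr_sumr; apply: eq_bigr => k _.
rewrite summxE !mulr_sumr; apply: eq_bigr => i _.
have -> : (c *: d) k 0 = c * d k 0 by rewrite mxE.
by rewrite [ystar + _]addrC mulrA.
Qed.

End Optimum.

Lemma block_ones_tens (R : realType) (N q : nat) (y : 'cV[R]_q) (i : 'I_N) :
  block (ones_tens N y) i = y.
Proof.
apply/colP => k; rewrite !mxE mxtens_indexK /= mul1r.
by congr (y _ _); rewrite ord1.
Qed.

Lemma block_inj (R : realType) (N q : nat) (Y Z : 'cV[R]_(N * q)) :
  (forall i, block Y i = block Z i) -> Y = Z.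
Proof.
move=> h; apply/colP => l; case: (mxtens_indexP l) => i k.
by have /colP /(_ k) := h i; rewrite !mxE.
Qed.

Lemma laplacian_tens_block (R : realType) (N q : nat) (a : 'M[R]_N)
    (Y : 'cV[R]_(N * q)) (i : 'I_N) (k : 'I_q) :
  ((laplacian a *t (1%:M : 'M[R]_q)) *m Y) (mxtens_index (i, k)) 0 =
  (laplacian a *m \col_j block Y j k 0) i 0.
Proof.
rewrite mxE [RHS]mxE (reindex (@mxtens_index N q)) /=; last first.
  by exists (@mxtens_unindex N q) => u _;
    [exact: mxtens_indexK|exact: mxtens_unindexK].
transitivity (\sum_j \sum_l laplacian a i j * (1%:M : 'M[R]_q) k l *
                Y (mxtens_index (j, l)) 0).
  by rewrite pair_bigA /=; apply: eq_bigr => -[j l] _; rewrite tensmxE.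
apply: eq_bigr => j _; rewrite (bigD1 k)//= big1 ?addr0 => [|l lk].
  by rewrite !mxE eqxx mulr1.
by rewrite [_%:M _ _]mxE eq_sym (negbTE lk) mulr0 mul0r.
Qed.

(** A vector killed by the Laplacian has no energy, hence equal entries by
    [energy_gap]. *)
Lemma consensus_kernel (R : realType) (N q : nat) (E : rel 'I_N) (a : 'M[R]_N)
    (r : 'I_N -> R) (Y : 'cV[R]_(N * q)) :
  (0 < N)%N -> adjacency_of E a -> strongly_connected E -> balancing a r ->
  (laplacian a *t (1%:M : 'M[R]_q)) *m Y = 0 <-> exists y, Y = ones_tens N y.
Proof.
move=> N0 aE sc ra; split=> [LY|[y ->]].
  exists (block Y (Ordinal N0)); apply: block_inj => i; rewrite block_ones_tens.
  apply/colP => k; have [c c0 gap] := energy_gap ra aE sc.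
  set w := fun j => block Y j k 0.
  have Lw j : \sum_l a j l * (w j - w l) = 0.
    have := laplacian_tens_block a Y j k.
    rewrite LY (laplacian_mulmxE _ _ aE) [LHS]mxE.
    by move=> /esym e; apply: etrans e; apply: eq_bigr => l _; rewrite /w !mxE.
  have := gap i (Ordinal N0) w; rewrite (energyE ra) big1 => [|j _]; last first.
    by rewrite Lw !mulr0.
  by rewrite !mulr0 real_exprn_even_le0 ?num_real//= subr_eq0 => /eqP.
apply/colP => l; case: (mxtens_indexP l) => i k.
rewrite laplacian_tens_block (laplacian_mulmxE _ _ aE) [RHS]mxE big1// => j _.
by rewrite [X in X - _]mxE [X in _ - X]mxE !block_ones_tens subrr mulr0.
Qed.

Lemma optimum_exists (R : realType) (N q : nat) (f : 'I_N -> 'cV[R]_q -> R)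
    (m M : 'I_N -> R) (E : rel 'I_N) (a : 'M[R]_N) (r : 'I_N -> R) :
  (0 < N)%N -> adjacency_of E a -> strongly_connected E -> balancing a r ->
  (forall i, [/\ continuously_differentiable (f i),
                 0 < m i, strongly_convex (m i) (f i),
                 0 < M i & globally_lipschitz (M i) (grad (f i))]) ->
  exists ystar : 'cV[R]_q,
    [/\ \sum_i grad (f i) ystar = 0,
        unique (optimal_solution setT (fun y => \sum_i f i y)) ystar &
        unique (optimal_solution
                  [set Y : 'cV[R]_(N * q) |
                     (laplacian a *t (1%:M : 'M[R]_q)) *m Y = 0]%classic
                  (fun Y => \sum_i f i (block Y i)))
               (ones_tens N ystar)].
Proof.
move=> N0 aE sc ra hf.
have m0 i : 0 < m i by have [] := hf i.
have fc i : strongly_convex (m i) (f i) by have [] := hf i.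
have fl i : globally_lipschitz (M i) (grad (f i)) by have [] := hf i.
have fd i x : differentiable (f i) x by have [[]] := hf i.
have [ys crit] := critical_point_exists N0 m0 fc fl.
have min y : y != ys -> \sum_i f i ys < \sum_i f i y.
  exact: (critical_point_minimum N0 m0 fc fd crit).
have minle y : \sum_i f i ys <= \sum_i f i y.
  by have [->//|/min/ltW] := eqVneq y ys.
have ker Y := @consensus_kernel R N q E a r Y N0 aE sc ra.
have blockE y : \sum_i f i (block (ones_tens N y) i) = \sum_i f i y.
  by apply: eq_bigr => i _; rewrite block_ones_tens.
exists ys; split=> //; split.
- by split=> // y _.
- move=> y [_ /(_ ys Logic.I) yle]; apply/esym/eqP/negPn/negP => /min.
  by rewrite ltNge yle.
- split; first by apply/ker; exists ys.
  by move=> Y /ker[y ->]; rewrite !blockE.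
- move=> Y [/ker[y ->] /(_ (ones_tens N ys))]; rewrite !blockE => yle.
  congr ones_tens; apply/esym/eqP/negPn/negP => /min.
  by rewrite ltNge yle//; apply/ker; exists ys.
Qed.

(** * Functions continuous on the closed half-line *)

Section HalfLine.
Context (R : realType).
Implicit Types g h : R -> R.

(** One-sided continuity at the initial time is what ties the conserved
    quantities to the initial values. *)
Definition cont0 g : Prop := ({within `[0%R, +oo[, continuous g})%classic.

Lemma cont0_cst (c : R) : cont0 (fun=> c).
Proof. by move=> t; exact: cst_continuous. Qed.

Lemma cont0D g h : cont0 g -> cont0 h -> cont0 (fun t => g t + h t).
Proof. by move=> cg ch t; apply: continuousD; [exact: cg|exact: ch]. Qed.

Lemma cont0M g h : cont0 g -> cont0 h -> cont0 (fun t => g t * h t).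
Proof. by move=> cg ch t; apply: continuousM; [exact: cg|exact: ch]. Qed.

Lemma cont0_sum (I : finType) (F : I -> R -> R) :
  (forall i, cont0 (F i)) -> cont0 (fun t => \sum_i F i t).
Proof.
move=> h; elim: (index_enum I) => [|i s IH].
  by under eq_fun do rewrite big_nil; exact: cont0_cst.
by under eq_fun do rewrite big_cons; exact: cont0D.
Qed.

Lemma cont0_entry (n : nat) (x : R -> 'cV[R]_n) (i : 'I_n) :
  ({within `[0%R, +oo[, continuous x})%classic -> cont0 (fun t => x t i 0).
Proof.
move=> cx t; exact: (cvg_comp _ _ (cx t) (@coord_continuous R n 1 i 0 _)).
Qed.

Lemma cont0_itv g (T : R) :
  cont0 g -> ({within `[0%R, T], continuous g})%classic.
Proof.
apply: continuous_subspaceW => t /=; rewrite !in_itv /= => /andP[-> _] //.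
Qed.

Lemma cont0_conserved g : cont0 g ->
  (forall t : R, 0 < t -> is_derive t 1 g 0) -> forall t : R, 0 <= t -> g t = g 0.
Proof.
move=> cg dg t t0.
have [|s _] := @MVT_segment R g (fun=> 0) 0 t t0 _ (cont0_itv (T := t) cg).
  by move=> s; rewrite in_itv /= => /andP[s0 _]; exact: dg.
by rewrite mul0r => /eqP; rewrite subr_eq0 => /eqP.
Qed.

Lemma cont0_bounded g (T : R) : cont0 g -> 0 <= T ->
  exists B, forall t, 0 <= t -> t <= T -> g t <= B.
Proof.
move=> cg T0; have [c _ h] := EVT_max T0 (cont0_itv (T := T) cg).
by exists (g c) => t t0 tT; apply: h; rewrite in_itv /= t0.
Qed.

End HalfLine.

(** * Distributed estimation of the balancing weights *)

Section Weights.
Context (R : realType) (N : nat) (E : rel 'I_N) (a : 'M[R]_N) (r : 'I_N -> R).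
Hypotheses (aE : adjacency_of E a) (sc : strongly_connected E).
Hypothesis ra : balancing a r.
Variable z : 'I_N -> R -> 'cV[R]_N.
Hypothesis z_solves : forall i,
  solves (z i) (fun t => - \sum_j a i j *: (z i t - z j t)).
Hypothesis z0 : forall i, z i 0 = delta_mx i 0.

(** The [k]-th components of the estimators obey the consensus protocol, which
    preserves their [r]-mean; initially it is [r k].  The [r]-weighted variance
    has derivative [- energy] and, the mean of the errors being zero, is bounded
    by a multiple of the energy. *)
Lemma weight_estimate_decays (k : 'I_N) :
  decays (fun t => (z k t k 0 - r k) ^+ 2).
Proof.
have [r0 r1 _] := ra.
pose e i (t : R) := z i t k 0 - r k.
have de i (t : R) : 0 < t ->
    is_derive t 1 (e i) (- \sum_j a i j * (e i t - e j t)).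
  move=> t0; have /is_derive_mxP /(_ k 0) := (z_solves i).2 t t0 => h.
  apply: is_derive_eq; rewrite subr0 mxE summxE; congr (- _).
  by apply: eq_bigr => j _; rewrite !mxE /e; ring.
have ce i : cont0 (e i).
  apply: cont0D; last exact: cont0_cst.
  by apply: cont0_entry; have [] := z_solves i.
have cons : forall t, 0 <= t -> \sum_i r i * e i t = \sum_i r i * e i 0.
  apply: (@cont0_conserved R (fun t => \sum_i r i * e i t)).
    by apply: cont0_sum => i; apply: cont0M => //; exact: cont0_cst.
  move=> s s0.
  have D : is_derive s 1 (fun t => \sum_i r i * e i t)
      (\sum_i - (r i * \sum_j a i j * (e i s - e j s))).
    apply: is_derive_sum_fun => i _; have := de i s s0 => h.
    by apply: is_derive_eq; rewrite /GRing.scale /= mulrN.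
  apply: (is_derive_eq D).
  by rewrite sumrN (balanced_conserved ra (fun i => e i s)) oppr0.
have mean t : 0 <= t -> \sum_i r i * e i t = 0.
  move=> /cons ->; rewrite /e; under eq_bigr do rewrite z0 mxE mulrBr eqxx andbT.
  rewrite sumrB -mulr_suml r1 mul1r (bigD1 k)//= eqxx mulr1 big1 ?addr0 ?subrr//.
  by move=> i ik; rewrite eq_sym (negbTE ik) mulr0.
have [c c0 gap] := energy_gap ra aE sc.
pose V t := \sum_i r i * e i t ^+ 2.
have VD (t : R) : 0 < t -> is_derive t 1 V (- energy a r (fun i => e i t)).
  move=> t0; rewrite (energyE ra) mulr_sumr -sumrN.
  apply: is_derive_sum_fun => i _; have := de i t t0 => h.
  by apply: is_derive_eq; rewrite /GRing.scale /=; ring.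
have Ve (t : R) : 0 <= t -> V t <= c * energy a r (fun i => e i t).
  move=> t0.
  have VE : V t = \sum_i r i * (e i t - e k t) ^+ 2 - e k t ^+ 2.
    transitivity (V t - 2 * e k t * (\sum_i r i * e i t) +
                  e k t ^+ 2 * (\sum_i r i) - e k t ^+ 2).
      by rewrite mean// r1; ring.
    congr (_ - _); rewrite /V !mulr_sumr -sumrB -big_split /=.
    by apply: eq_bigr => i _; ring.
  have : \sum_i r i * (e i t - e k t) ^+ 2 <=
         \sum_i r i * (c * energy a r (fun i => e i t)).
    by apply: ler_sum => i _; rewrite ler_pM2l// (gap i k (fun i => e i t)).
  by rewrite -mulr_suml r1 mul1r VE; have := sqr_ge0 (e k t); lra.
have Vdecays : decays V.
  apply: (@decays_linear_ineq R V (fun t => - energy a r (fun i => e i t))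
    (fun=> 0) c^-1 _ (decays0 R)); first by rewrite invr_gt0.
  near=> t; have t0 : 0 < t by near: t; apply: nbhs_pinfty_gt; exact: num_real.
  split; [|exact: VD|].
    by apply: sumr_ge0 => i _; rewrite mulr_ge0 ?sqr_ge0// ltW.
  by rewrite addr0 mulNr lerN2 mulrC ler_pdivrMr// mulrC Ve// ltW.
apply: decays_le (decaysZ (r k)^-1 Vdecays) _; near=> t.
rewrite ger0_norm ?sqr_ge0//; apply: le_trans (ler_norm _).
rewrite mulrC ler_pdivlMr// mulrC /V (bigD1 k)//= lerDl.
by apply: sumr_ge0 => i _; rewrite mulr_ge0 ?sqr_ge0// ltW.
Unshelve. all: by end_near. Qed.

(** The factor [4 / r^4] bounds [1 / (r z)^2] as soon as [z >= r / 2]. *)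
Lemma weight_inverse_decays (k : 'I_N) :
  decays (fun t => ((r k)^-1 - (z k t k 0)^-1) ^+ 2).
Proof.
have [r0 _ _] := ra; have dz := weight_estimate_decays k.
apply: decays_le (decaysZ (4 / r k ^+ 4) dz) _.
have rk : 0 < r k by exact: r0.
have h0 : 0 < (r k / 2) ^+ 2 by rewrite exprn_gt0 ?divr_gt0.
near=> t.
have : `|(z k t k 0 - r k) ^+ 2| <= (r k / 2) ^+ 2.
  by near: t; exact: decays_small dz h0.
rewrite ger0_norm ?sqr_ge0// => zr.
rewrite ger0_norm ?sqr_ge0//; apply: le_trans (ler_norm _).
move: zr rk; set w := z k t k 0; set s := r k => zr rk.
have w2 : s / 2 <= w.
  rewrite leNgt; apply/negP => ws.
  have : (s / 2) ^+ 2 < (s - w) ^+ 2.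
    by rewrite ltr_sqr ?nnegrE; lra.
  by rewrite -[s - w]opprB sqrrN ltNge zr.
have w0 : 0 < w by apply: lt_le_trans w2; rewrite divr_gt0.
have -> : (s^-1 - w^-1) ^+ 2 = (w - s) ^+ 2 / (s ^+ 2 * w ^+ 2).
  by field; rewrite !gt_eqF.
rewrite [leRHS]mulrC ler_wpM2l ?sqr_ge0//.
rewrite invf_ple ?posrE ?divr_gt0 ?mulr_gt0 ?exprn_gt0//.
have -> : (4 / s ^+ 4)^-1 = s ^+ 2 * (s / 2) ^+ 2 by field; rewrite gt_eqF.
by rewrite ler_pM2l ?exprn_gt0// ler_sqr ?nnegrE//; lra.
Unshelve. all: by end_near. Qed.

End Weights.

(** * The Lyapunov inequality *)

(** One component of one agent.  Young's inequality is applied three times: to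
    [v h] with weights that strong convexity and [G] can afford, to [d v] with
    half of the term [G rho v^2], and to the perturbation [eps h + w] with
    weight [m / 8], small enough to leave a definite term in [y] and [v]. *)
Lemma lyapunov_cell (F : realFieldType) (m M rho G y v d h eps w : F) :
  0 < m -> 0 < M -> 0 < rho -> rho <= 1 -> M ^+ 2 / m + 4 * m <= G * rho ->
  - 2 * (y * h) - v * h - 2 * G * rho * (d * v) - G * rho * v ^+ 2
    + rho * ((2 * y + v) * (eps * h + w)) <=
  - 2 * (y * h) + (m / (2 * M ^+ 2) + 8 / m * eps ^+ 2) * h ^+ 2
    + m / 2 * y ^+ 2 - m / 2 * v ^+ 2 + 2 * G * (rho * d ^+ 2) + 8 / m * w ^+ 2.
Proof.
move=> m0 M0 rho0 rho1 hG.
have M2m : 0 < M ^+ 2 / m by rewrite divr_gt0 ?exprn_gt0.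
have Grho : 0 <= G * rho by apply: le_trans hG; lra.
have ya := young_ineq (- v) h M2m.
have yb : - 2 * (d * v) <= v ^+ 2 / 2 + 2 * d ^+ 2.
  by have := sqr_ge0 (2 * d + v); lra.
have {yb} := ler_wpM2l Grho yb.
have yc : (2 * y + v) * (eps * h + w) <=
    m / 2 * y ^+ 2 + m / 8 * v ^+ 2 + 8 / m * (eps ^+ 2 * h ^+ 2 + w ^+ 2).
  have m8 : 0 < m / 8 by lra.
  have := young_ineq (2 * y + v) (eps * h + w) m8.
  have -> : (m / 8)^-1 = 8 / m by field; lra.
  have e1 := ler_wpM2l (ltW m8) (sqr_ge0 (2 * y - v)).
  have m8' : 0 <= 8 / m by rewrite divr_ge0// ltW.
  have := ler_wpM2l m8' (sqr_ge0 (eps * h - w)).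
  move: e1; lra.
have B0 : 0 <= m / 2 * y ^+ 2 + m / 8 * v ^+ 2
    + 8 / m * (eps ^+ 2 * h ^+ 2 + w ^+ 2).
  have m2 : 0 <= m / 2 by lra.
  have m8 : 0 <= m / 8 by lra.
  have m8' : 0 <= 8 / m by rewrite divr_ge0// ltW.
  have p (x : F) : 0 <= x ^+ 2 by exact: sqr_ge0.
  by do ?[done | exact: p | apply: addr_ge0 | apply: mulr_ge0].
have {yc} := le_trans (ler_wpM2l (ltW rho0) yc) (ler_piMl B0 rho1).
have := ler_wpM2r (sqr_ge0 v) hG.
have := mulr_ge0 (ltW m0) (sqr_ge0 v).
move: ya.
have -> : (M ^+ 2 / m)^-1 = m / M ^+ 2 by field; rewrite !gt_eqF.
have -> : m / (2 * M ^+ 2) = m / M ^+ 2 / 2 by field; rewrite gt_eqF.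
move: (m / M ^+ 2) (M ^+ 2 / m) (8 / m) => A1 A2 A3.
by lra.
Qed.

Section Lyapunov.
Context (R : realType) (N q : nat) (a : 'M[R]_N) (r : 'I_N -> R).
Hypothesis ra : balancing a r.
Variables (c r0 m M : R) (i0 : 'I_N).
Hypotheses (c_gt0 : 0 < c) (r0_gt0 : 0 < r0) (m_gt0 : 0 < m) (M_gt0 : 0 < M).
Hypothesis r0_le : forall i, r0 <= r i.
Hypothesis gap : forall i j y, (y i - y j) ^+ 2 <= c * energy a r y.

(** Chosen so that [gain2 * r i >= M^2 / m + 4 m], the hypothesis of
    [lyapunov_cell]. *)
Definition gain2 : R := (M ^+ 2 / m + 4 * m) / r0.
(** Chosen so that the dissipated energy [gain1 / 2 * energy] dominates the terms
    [2 * gain2 * r i * (y i - y i0)^2] through the spectral gap [c]. *)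
Definition gain1 : R := 4 * gain2 * c.

Lemma gain2_gt0 : 0 < gain2.
Proof.
apply: divr_gt0 => //; apply: addr_gt0; last by rewrite mulr_gt0.
by rewrite divr_gt0 ?exprn_gt0.
Qed.

Lemma gain1_gt0 : 0 < gain1.
Proof. by do ?[exact: gain2_gt0 | apply: mulr_gt0]. Qed.

Lemma balancing_le1 i : r i <= 1.
Proof.
have [rp <- _] := ra; rewrite (bigD1 i)//= lerDl; apply: sumr_ge0 => j _.
exact: ltW.
Qed.

(** Left is half the derivative of [V = sum r_i (y_i^2 + (y_i + v_i)^2)].  The
    constraint on [v] allows [y i k * v i k] to be replaced by
    [(y i k - y i0 k) * v i k] after summation, so that the cross term is
    controlled by the energy. *)
Lemma lyapunov_ineq (y v h w dis deta : 'I_N -> 'I_q -> R)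
    (eps : 'I_N -> R) :
  (forall i, m * \sum_k y i k ^+ 2 <= \sum_k y i k * h i k) ->
  (forall i, \sum_k h i k ^+ 2 <= M ^+ 2 * \sum_k y i k ^+ 2) ->
  (forall k, \sum_i r i * v i k = 0) ->
  (forall i, eps i ^+ 2 <= m ^+ 2 / (32 * M ^+ 2)) ->
  (forall i k, dis i k = \sum_j a i j * (y i k - y j k)) ->
  (forall i k, deta i k =
     - (h i k / r i) - gain2 * v i k + (eps i * h i k + w i k)) ->
  \sum_i \sum_k
     r i * (y i k * (deta i k - gain1 * dis i k) + (y i k + v i k) * deta i k) <=
  - (m / 2) * \sum_i \sum_k (y i k ^+ 2 + v i k ^+ 2)
    + 8 / m * \sum_i \sum_k w i k ^+ 2.
Proof.
move=> mon lip mean small disE detaE; have [rp r1 _] := ra.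
pose T i k := - 2 * (y i k * h i k) - v i k * h i k
   - 2 * gain2 * r i * ((y i k - y i0 k) * v i k) - gain2 * r i * v i k ^+ 2
   + r i * ((2 * y i k + v i k) * (eps i * h i k + w i k)).
have -> : \sum_i \sum_k
     r i * (y i k * (deta i k - gain1 * dis i k) + (y i k + v i k) * deta i k) =
   \sum_i \sum_k T i k
   - (\sum_k gain1 / 2 * energy a r (fun i => y i k)).
  transitivity (\sum_i \sum_k T i k
   - (\sum_k (gain1 * (\sum_i r i * (y i k * dis i k)) +
          2 * gain2 * y i0 k * \sum_i r i * v i k))).
    rewrite [X in _ = X - _]exchange_big [LHS]exchange_big /= -sumrB /=.
    apply: eq_bigr => k _; rewrite !mulr_sumr -big_split -sumrB /=.
    apply: eq_bigr => i _; rewrite /T detaE; field.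
    by rewrite gt_eqF.
  congr (_ - _); apply: eq_bigr => k _; rewrite mean mulr0 addr0 (energyE ra).
  by under eq_bigr do rewrite disE; field.
have hG i : M ^+ 2 / m + 4 * m <= gain2 * r i.
  have -> : M ^+ 2 / m + 4 * m = gain2 * r0.
    by rewrite /gain2 divfK// gt_eqF.
  by rewrite ler_pM2l ?gain2_gt0.
pose U i k := - 2 * (y i k * h i k)
  + (m / (2 * M ^+ 2) + 8 / m * eps i ^+ 2) * h i k ^+ 2
  + m / 2 * y i k ^+ 2 - m / 2 * v i k ^+ 2
  + 2 * gain2 * (r i * (y i k - y i0 k) ^+ 2) + 8 / m * w i k ^+ 2.
have TU : \sum_i \sum_k T i k <= \sum_i \sum_k U i k.
  apply: ler_sum => i _; apply: ler_sum => k _.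
  exact: (lyapunov_cell _ _ _ _ _ _ m_gt0 M_gt0 (rp i) (balancing_le1 i) (hG i)).
have sumU : \sum_i \sum_k U i k <=
   - (m / 2) * \sum_i \sum_k (y i k ^+ 2 + v i k ^+ 2)
    + 8 / m * \sum_i \sum_k w i k ^+ 2
    + 2 * gain2 * \sum_i \sum_k (r i * (y i k - y i0 k) ^+ 2).
  rewrite !mulr_sumr -!big_split /=; apply: ler_sum => i _.
  have -> : \sum_k U i k = - 2 * (\sum_k y i k * h i k)
     + (m / (2 * M ^+ 2) + 8 / m * eps i ^+ 2) * (\sum_k h i k ^+ 2)
     + m / 2 * (\sum_k y i k ^+ 2) - m / 2 * (\sum_k v i k ^+ 2)
     + 2 * gain2 * (\sum_k r i * (y i k - y i0 k) ^+ 2)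
     + 8 / m * (\sum_k w i k ^+ 2).
    by rewrite !mulr_sumr -sumrN -!big_split.
  rewrite big_split /=.
  set Y := \sum_k y i k ^+ 2; set H := \sum_k h i k ^+ 2.
  have Y0 : 0 <= Y by apply: sumr_ge0 => k _; exact: sqr_ge0.
  have coef : 0 <= m / (2 * M ^+ 2) + 8 / m * eps i ^+ 2.
    apply: addr_ge0; first by rewrite divr_ge0 ?mulr_ge0 ?sqr_ge0// ltW.
    by apply: mulr_ge0; rewrite ?sqr_ge0// divr_ge0// ltW.
  have e1 := ler_wpM2l coef (lip i).
  have coef2 : (m / (2 * M ^+ 2) + 8 / m * eps i ^+ 2) * M ^+ 2 <= 3 / 4 * m.
    have : 8 / m * eps i ^+ 2 * M ^+ 2 <=
        8 / m * (m ^+ 2 / (32 * M ^+ 2)) * M ^+ 2.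
      by rewrite ler_wpM2r ?sqr_ge0// ler_wpM2l ?divr_ge0// ltW.
    have -> : 8 / m * (m ^+ 2 / (32 * M ^+ 2)) * M ^+ 2 = m / 4.
      by field; rewrite !gt_eqF.
    have -> : (m / (2 * M ^+ 2) + 8 / m * eps i ^+ 2) * M ^+ 2 =
       m / 2 + 8 / m * eps i ^+ 2 * M ^+ 2 by field; rewrite !gt_eqF.
    by lra.
  have := ler_wpM2r Y0 coef2; move: e1 (mon i); rewrite -/Y -/H.
  have := mulr_ge0 (ltW m_gt0) Y0; lra.
have gapQ : 2 * gain2 * (\sum_i \sum_k r i * (y i k - y i0 k) ^+ 2) <=
   \sum_k gain1 / 2 * energy a r (fun i => y i k).
  rewrite exchange_big mulr_sumr /=; apply: ler_sum => k _.
  have -> : gain1 / 2 * energy a r (fun i => y i k) =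
     2 * gain2 * \sum_i r i * (c * energy a r (fun i => y i k)).
    by rewrite -mulr_suml r1 mul1r /gain1; field.
  have g2 : 0 < 2 * gain2 by rewrite mulr_gt0 ?gain2_gt0.
  rewrite ler_pM2l//. apply: ler_sum => i _.
  by rewrite ler_pM2l// (gap i i0 (fun i => y i k)).
move: TU sumU gapQ; lra.
Qed.

End Lyapunov.

(** * Convergence of the closed loop *)

Lemma col_subE (R : realType) (n : nat) (u w : 'cV[R]_n) (k : 'I_n) :
  (u - w) k 0 = u k 0 - w k 0.
Proof. by rewrite !mxE. Qed.

Lemma decays_mulmx (R : realType) (m n : nat) (Q : 'M[R]_(m, n))
    (x : R -> 'cV[R]_n) :
  decays (fun t => sqn (x t)) -> decays (fun t => sqn (Q *m x t)).
Proof.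
move=> /(decaysZ (\sum_k n%:R * \sum_j Q k j ^+ 2)) dx.
apply: (decays_le dx); near=> t; rewrite ger0_norm ?sqn_ge0//.
apply: le_trans (ler_norm _); rewrite mulr_suml; apply: ler_sum => k _.
rewrite mxE (le_trans (sqr_sum_le _))// -mulrA ler_wpM2l// mulr_suml.
apply: ler_sum => j _; rewrite exprMn ler_wpM2l ?sqr_ge0//.
by rewrite /sqn (bigD1 j)//= lerDl; apply: sumr_ge0 => l _; exact: sqr_ge0.
Unshelve. all: by end_near. Qed.

(** On a compact initial interval continuity bounds what the eventual estimate
    leaves open. *)
Lemma decays_converges (R : realType) (n : nat) (Y : R -> 'cV[R]_n)
    (Ybar : 'cV[R]_n) :
  cont0 (fun t => sqn (Y t - Ybar)) -> decays (fun t => sqn (Y t - Ybar)) ->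
  converges_exponentially Y Ybar.
Proof.
move=> cY [c [al [c0 al0 [T [_ HT]]]]].
pose T1 := `|T| + 1.
have T10 : 0 <= T1 by rewrite /T1 addr_ge0.
have TT1 : T < T1 by rewrite /T1; have := ler_norm T; lra.
have [B HB] := cont0_bounded cY T10.
pose k := c + `|B| * expR (al * T1).
have k0 : 0 <= k by rewrite addr_ge0 ?mulr_ge0 ?expR_ge0.
exists (Num.sqrt k), (al / 2); split; [exact: sqrtr_ge0|by rewrite divr_gt0|].
move=> t t0; rewrite -ler_sqr ?nnegrE ?mulr_ge0 ?sqrtr_ge0 ?expR_ge0//.
rewrite enorm_sqr exprMn sqr_sqrtr// expr2 -expRD.
have -> : - (al / 2) * t + - (al / 2) * t = - al * t by field.
have [tT|tT] := leP t T1; last first.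
  apply: (le_trans (ler_norm _)); apply: (le_trans (HT t (lt_trans TT1 tT))).
  by rewrite ler_wpM2r ?expR_ge0// lerDl mulr_ge0 ?expR_ge0.
apply: (le_trans (HB t t0 tT)); apply: (le_trans (ler_norm _)).
apply: (@le_trans _ _ (`|B| * expR (al * T1) * expR (- al * t))).
  rewrite -mulrA -expRD ler_peMr//.
  by rewrite -expR0 ler_expR mulNr -mulrBr mulr_ge0 ?subr_ge0// ltW.
by rewrite ler_wpM2r ?expR_ge0// lerDr.
Qed.

Section Convergence.
Context (R : realType) (N q : nat) (n p : 'I_N -> nat).
Variables (A : forall i, 'M[R]_(n i)) (B : forall i, 'M[R]_(n i, p i))
  (C : forall i, 'M[R]_(q, n i)) (K : forall i, 'M[R]_(p i, n i))
  (Ups Phi : forall i, 'M[R]_(p i, q)) (Psi : forall i, 'M[R]_(n i, q))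
  (f : 'I_N -> 'cV[R]_q -> R) (E : rel 'I_N) (a : 'M[R]_N)
  (r : 'I_N -> R) (i0 : 'I_N) (m M c r0 : R) (ystar : 'cV[R]_q).
Hypotheses (aE : adjacency_of E a) (sc : strongly_connected E).
Hypothesis ra : balancing a r.
Hypotheses (r0_gt0 : 0 < r0) (m_gt0 : 0 < m) (M_gt0 : 0 < M).
Hypothesis r0_le : forall i, r0 <= r i.
Hypothesis gap : forall i j y, (y i - y j) ^+ 2 <= c * energy a r y.
Hypothesis f_convex : forall i, strongly_convex m (f i).
Hypothesis f_lip : forall i, globally_lipschitz M (grad (f i)).
Hypothesis crit : \sum_i grad (f i) ystar = 0.
Hypothesis hK : forall i, hurwitz (A i - B i *m K i).
Hypothesis regulator : forall i, [/\ C i *m Psi i - 1%:M = 0,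
                 B i *m Phi i - A i *m Psi i = 0
               & B i *m Ups i - Psi i = 0].

Let g1 := gain1 c r0 m M.
Let g2 := gain2 r0 m M.

Variables (x : forall i, R -> 'cV[R]_(n i)) (rho v : 'I_N -> R -> 'cV[R]_q)
  (z : 'I_N -> R -> 'cV[R]_N).
Hypothesis traj : closed_loop_trajectory A B C K Ups Phi Psi f a g1 g2 x rho v z.

Let om i t := omega C f a g1 g2 x v z i t.
Let y i t := output C x i t.
Let xb i t := x i t - Psi i *m rho i t.

(** The control is a feedback on [x - Psi rho]: the terms in [rho] regroup because
    [B Phi = A Psi], those in [omega] because [B Ups = Psi]. *)
Lemma closed_loop_field i t :
  A i *m x i t + B i *m control C K Ups Phi Psi f a g1 g2 x rho v z i t =
  (A i - B i *m K i) *m xb i t + Psi i *m om i t.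
Proof.
have [_ /eqP + /eqP] := regulator i; rewrite !subr_eq0 => /eqP BPhi /eqP BUps.
rewrite /control -/(om i t) /xb.
move: (om i t) (x i t) (rho i t) => o X P.
rewrite !mulmxBl !mulmxBr mulmxDr mulmxN !mulmxA BUps BPhi.
by apply/colP => k; rewrite ![in LHS]mxE ![in RHS]mxE; ring.
Qed.

Lemma is_derive_xb i (t : R) : 0 < t ->
  is_derive t 1 (xb i) ((A i - B i *m K i) *m xb i t).
Proof.
move=> t0; have [[_ dx] [_ dr] _ _ _] := traj i.
have {}dx := dx t t0; have {}dr := is_derive_mulmx (Psi i) (dr t t0).
by apply: is_derive_eq; rewrite closed_loop_field addrK.
Qed.

Lemma xb_decays i : decays (fun t => sqn (xb i t)).
Proof.
by apply: (@hurwitz_decays R _ _ (xb i) (@hK i)) => t; exact: is_derive_xb.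
Qed.

Let d i t := C i *m (A i - B i *m K i) *m xb i t.

Lemma is_derive_output i (t : R) : 0 < t -> is_derive t 1 (y i) (om i t + d i t).
Proof.
move=> t0; have [[_ dx] _ _ _ _] := traj i.
have [/eqP + _ _] := regulator i; rewrite subr_eq0 => /eqP CPsi.
have dy := is_derive_mulmx (C i) (dx t t0); apply: (is_derive_eq dy).
by rewrite closed_loop_field mulmxDr !mulmxA CPsi mul1mx addrC.
Qed.

Let yt i k t := y i t k 0 - ystar k 0.
Let gs i k := grad (f i) ystar k 0.
Let vt i k t := v i t k 0 + gs i k / (g2 * r i).
Let h i k t := grad (f i) (y i t) k 0 - gs i k.
Let eps i t := (r i)^-1 - (z i t i 0)^-1.
Let w i k t := d i t k 0 + eps i t * gs i k.
Let dis i k t := \sum_j a i j * (yt i k t - yt j k t).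
Let deta i k t :=
  - (h i k t / r i) - g2 * vt i k t + (eps i t * h i k t + w i k t).

Let r_gt0 i : 0 < r i. Proof. by have [] := ra. Qed.
Let g2_gt0 : 0 < g2. Proof. exact: gain2_gt0. Qed.

Lemma disagreementE i k t : disagreement C a x i t k 0 = dis i k t.
Proof.
rewrite /disagreement summxE; apply: eq_bigr => j _.
by rewrite mxE [X in _ * X = _]mxE [X in _ * (_ + X) = _]mxE /yt /y; ring.
Qed.

Lemma is_derive_yt i k (t : R) : 0 < t ->
  is_derive t 1 (yt i k) (deta i k t - g1 * dis i k t).
Proof.
move=> t0; have /is_derive_mxP /(_ k 0) dy := is_derive_output i t0.
apply: is_derive_eq; rewrite subr0 mxE.
have -> : om i t k 0 = - ((z i t i 0)^-1 * grad (f i) (y i t) k 0)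
    - g1 * dis i k t - g2 * v i t k 0.
  by rewrite -disagreementE /om /omega !mxE.
have ri := lt0r_neq0 (r_gt0 i); have g2n := lt0r_neq0 g2_gt0.
rewrite /deta /w /vt /eps /h; move: (z i t i 0)^-1 => zi; field.
by rewrite ri g2n.
Qed.

Lemma is_derive_vt i k (t : R) : 0 < t ->
  is_derive t 1 (vt i k) (g1 * dis i k t).
Proof.
move=> t0; have [_ _ [_ dv] _ _] := traj i.
have /is_derive_mxP /(_ k 0) {}dv := dv t t0.
by apply: is_derive_eq; rewrite addr0 mxE disagreementE.
Qed.

(** [sum r_i v_i] is conserved, since the weights balance the disagreement, and
    it starts from zero; the shifts add up to the gradient of the sum at
    [ystar]. *)
Lemma vt_mean k (t : R) : 0 <= t -> \sum_i r i * vt i k t = 0.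
Proof.
have cons : forall t, 0 <= t ->
    \sum_i r i * v i t k 0 = \sum_i r i * v i 0 k 0.
  apply: (@cont0_conserved R (fun t => \sum_i r i * v i t k 0)).
    apply: cont0_sum => i; apply: cont0M; first exact: cont0_cst.
    by apply: cont0_entry; have [_ _ [cv _] _ _] := traj i.
  move=> s s0.
  have D : is_derive s 1 (fun t => \sum_i r i * v i t k 0)
      (\sum_i r i * (g1 * dis i k s)).
    apply: is_derive_sum_fun => i _; have [_ _ [_ dv] _ _] := traj i.
    have /is_derive_mxP /(_ k 0) {}dv := dv s s0.
    by apply: is_derive_eq; rewrite /GRing.scale /= mxE disagreementE.
  apply: (is_derive_eq D); under eq_bigr do rewrite mulrCA.
  by rewrite -mulr_sumr (balanced_conserved ra (fun i => yt i k s)) mulr0.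
move=> t0; transitivity (\sum_i r i * v i t k 0 + g2^-1 * \sum_i gs i k).
  rewrite mulr_sumr -big_split /=; apply: eq_bigr => i _.
  by rewrite /vt; field; rewrite (lt0r_neq0 (r_gt0 i)) (lt0r_neq0 g2_gt0).
rewrite cons// big1 => [|i _]; last first.
  by have [_ _ _ _ [-> _]] := traj i; rewrite mxE mulr0.
have -> : \sum_i gs i k = (\sum_i grad (f i) ystar) k 0 by rewrite summxE.
by rewrite crit mxE mulr0 addr0.
Qed.

Lemma perturbation_decays : decays (fun t => \sum_i \sum_k w i k t ^+ 2).
Proof.
apply: decays_sum => i; apply: decays_sum => k.
have dd := decays_mulmx (C i *m (A i - B i *m K i)) (xb_decays i).
have de : decays (fun t => eps i t ^+ 2).
  apply: (weight_inverse_decays aE sc ra) => j; first by have [_ _ _] := traj j.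
  by have [_ _ _ _ []] := traj j.
apply: (decays_le (decaysD (decaysZ 2 dd) (decaysZ (2 * gs i k ^+ 2) de))).
near=> t; rewrite ger0_norm ?sqr_ge0//; apply: le_trans (ler_norm _).
have : d i t k 0 ^+ 2 <= sqn (d i t).
  by rewrite /sqn (bigD1 k)//= lerDl; apply: sumr_ge0 => l _; exact: sqr_ge0.
rewrite -/(d i t) /w; move: (d i t k 0) (sqn _) (eps i t) (gs i k) => u1 u2 u3 u4.
have := sqr_ge0 (u1 - u3 * u4); lra.
Unshelve. all: by end_near. Qed.

(* The derivative of [yt + vt] along the closed loop is [deta]. *)
Let V t := \sum_i \sum_k r i * (yt i k t ^+ 2 + (yt i k t + vt i k t) ^+ 2).
Let dV t := 2 * \sum_i \sum_k r i *
  (yt i k t * (deta i k t - g1 * dis i k t) + (yt i k t + vt i k t) * deta i k t).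

Lemma is_derive_V (t : R) : 0 < t -> is_derive t 1 V (dV t).
Proof.
move=> t0; rewrite /dV mulr_sumr; apply: is_derive_sum_fun => i _.
rewrite mulr_sumr; apply: is_derive_sum_fun => k _.
have := is_derive_yt i k t0; have := is_derive_vt i k t0 => dv dy.
by apply: is_derive_eq; rewrite /GRing.scale /=; ring.
Qed.

Lemma V_le t : V t <= 3 * \sum_i \sum_k (yt i k t ^+ 2 + vt i k t ^+ 2).
Proof.
rewrite mulr_sumr; apply: ler_sum => i _; rewrite mulr_sumr.
apply: ler_sum => k _; move: (yt i k t) (vt i k t) => u1 u2.
have B0 : 0 <= u1 ^+ 2 + (u1 + u2) ^+ 2 by rewrite addr_ge0 ?sqr_ge0.
apply: (le_trans (ler_piMl B0 (balancing_le1 ra i))).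
have := sqr_ge0 (u1 - u2); have := sqr_ge0 u2; lra.
Qed.

Lemma V_decays : decays V.
Proof.
have m3 : 0 < m / 3 by rewrite divr_gt0.
have k0 : 0 < m ^+ 2 / (32 * M ^+ 2).
  by rewrite divr_gt0 ?mulr_gt0 ?exprn_gt0.
apply: (decays_linear_ineq m3 (decaysZ (16 / m) perturbation_decays) (dV := dV)).
near=> t; have t0 : 0 < t by near: t; apply: nbhs_pinfty_gt; exact: num_real.
split; [|exact: is_derive_V|].
  apply: sumr_ge0 => i _; apply: sumr_ge0 => k _.
  by rewrite mulr_ge0 ?addr_ge0 ?sqr_ge0// ltW.
have ineq := @lyapunov_ineq R N q a r ra c r0 m M i0 r0_gt0 m_gt0 M_gt0
  r0_le (@gap) (fun i k => yt i k t) (fun i k => vt i k t) (fun i k => h i k t)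
  (fun i k => w i k t) (fun i k => dis i k t) (fun i k => deta i k t)
  (fun i => eps i t).
have {ineq} : \sum_i \sum_k r i *
    (yt i k t * (deta i k t - g1 * dis i k t) + (yt i k t + vt i k t) * deta i k t)
   <= - (m / 2) * \sum_i \sum_k (yt i k t ^+ 2 + vt i k t ^+ 2)
      + 8 / m * \sum_i \sum_k w i k t ^+ 2.
  apply: ineq => //.
  - move=> i; have := strongly_convex_sqn (y i t) ystar (@f_convex i).
    have -> : sqn (y i t - ystar) = \sum_k yt i k t ^+ 2.
      by apply: eq_bigr => k _; rewrite col_subE.
    move=> /le_trans; apply; apply: ler_sum => k _.
    by rewrite !col_subE.
  - move=> i; have := globally_lipschitz_sqn (y i t) ystar (@f_lip i).
    have -> : sqn (y i t - ystar) = \sum_k yt i k t ^+ 2.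
      by apply: eq_bigr => k _; rewrite col_subE.
    apply: le_trans; apply: ler_sum => k _.
    by rewrite col_subE.
  - by move=> k; apply: vt_mean; exact: ltW.
  - move=> i; apply: (le_trans (ler_norm _)).
    move: i; near: t; apply: filter_forall => i.
    apply: decays_small k0; apply: (weight_inverse_decays aE sc ra) => j.
      by have [_ _ _] := traj j.
    by have [_ _ _ _ []] := traj j.
move=> ineq; have := ler_wpM2l (ltW m3) (V_le t).
rewrite /dV; have -> : 16 / m = 2 * (8 / m) by field; rewrite gt_eqF.
by move: ineq; lra.
Unshelve. all: by end_near. Qed.

Lemma output_converges :
  converges_exponentially (fun t => stack (fun i => output C x i t))
    (ones_tens N ystar).
Proof.
have sqnE t : sqn (stack (fun i => y i t) - ones_tens N ystar) =
    \sum_i \sum_k yt i k t ^+ 2.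
  rewrite /sqn (reindex (@mxtens_index N q)) /=; last first.
    by exists (@mxtens_unindex N q) => u _;
      [exact: mxtens_indexK|exact: mxtens_unindexK].
  rewrite pair_bigA /=; apply: eq_bigr => -[i k] _ /=; congr (_ ^+ 2).
  rewrite col_subE [X in X - _]mxE mxtens_indexK /=; congr (_ - _).
  by have /colP /(_ k) := block_ones_tens ystar i; rewrite mxE.
apply: decays_converges.
  under eq_fun do rewrite sqnE; apply: cont0_sum => i; apply: cont0_sum => k.
  have cy : cont0 (yt i k).
    apply: cont0D; last exact: cont0_cst.
    rewrite /y /output; under eq_fun do rewrite mxE; apply: cont0_sum => j.
    apply: cont0M; first exact: cont0_cst.
    by apply: cont0_entry; have [[]] := traj i.
  by under eq_fun do rewrite expr2; exact: cont0M.
under eq_fun do rewrite sqnE.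
apply: (decays_le (decaysZ r0^-1 V_decays)); near=> t.
rewrite ger0_norm; last first.
  by apply: sumr_ge0 => i _; apply: sumr_ge0 => k _; exact: sqr_ge0.
apply: le_trans (ler_norm _); rewrite mulrC ler_pdivlMr//.
rewrite mulr_suml; apply: ler_sum => i _.
rewrite mulr_suml; apply: ler_sum => k _.
rewrite mulrC ler_pM ?sqr_ge0 ?(ltW r0_gt0)// lerDl; exact: sqr_ge0.
Unshelve. all: by end_near. Qed.

End Convergence.

Lemma le_sum_pos (R : realType) (N : nat) (g : 'I_N -> R) (i : 'I_N) :
  (forall i, 0 < g i) -> g i <= \sum_j g j.
Proof.
move=> g0; rewrite (bigD1 i)//= lerDl; apply: sumr_ge0 => j _; exact: ltW.
Qed.

(** The reciprocal of [1 + sum 1 / g i] also makes sense for an empty family. *)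
Lemma pos_lower_bound (R : realType) (N : nat) (g : 'I_N -> R) :
  (forall i, 0 < g i) -> exists2 e, 0 < e & forall i, e <= g i.
Proof.
move=> g0.
have gV i : 0 < (g i)^-1 by rewrite invr_gt0.
have s0 : 0 < 1 + \sum_i (g i)^-1.
  by rewrite ltr_pwDl// sumr_ge0// => i _; exact: ltW.
exists (1 + \sum_i (g i)^-1)^-1 => [|i]; first by rewrite invr_gt0.
rewrite -[g i]invrK lef_pV2 ?posrE//.
apply: le_trans (le_sum_pos i gV) _; lra.
Qed.

Lemma strongly_convexW (R : realType) (q : nat) (m m' : R)
    (f : 'cV[R]_q -> R) : m' <= m -> strongly_convex m f -> strongly_convex m' f.
Proof.
move=> mm' h x y; apply: le_trans (h x y); rewrite ler_wpM2r//; exact: sqr_ge0.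
Qed.

Lemma globally_lipschitzW (R : realType) (q : nat) (M M' : R)
    (g : 'cV[R]_q -> 'cV[R]_q) :
  M <= M' -> globally_lipschitz M g -> globally_lipschitz M' g.
Proof.
move=> MM' h x y; apply: le_trans (h x y) _; rewrite ler_wpM2r// sqrtr_ge0//.
Qed.

Unset Implicit Arguments.

Theorem theorem1 (R : realType) (N q : nat) (N_gt0 : (0 < N)%N)
    (n p : 'I_N -> nat)
    (A : forall i, 'M[R]_(n i)) (B : forall i, 'M[R]_(n i, p i))
    (C : forall i, 'M[R]_(q, n i))
    (f : 'I_N -> 'cV[R]_q -> R) (m M : 'I_N -> R)
    (E : rel 'I_N) (a : 'M[R]_N)
    (K : forall i, 'M[R]_(p i, n i))
    (Ups Phi : forall i, 'M[R]_(p i, q)) (Psi : forall i, 'M[R]_(n i, q)) :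
  (forall i, [/\ continuously_differentiable (f i),
                 0 < m i, strongly_convex (m i) (f i),
                 0 < M i & globally_lipschitz (M i) (grad (f i))]) ->
  adjacency_of E a ->
  strongly_connected E ->
  (forall i, stabilizable (A i) (B i) /\
     \rank (block_mx (C i *m B i) (0 : 'M[R]_(q, p i))
                     (- (A i *m B i)) (B i)) = (n i + q)%N) ->
  (forall i, hurwitz (A i - B i *m K i)) ->
  (forall i, [/\ C i *m Psi i - 1%:M = 0,
                 B i *m Phi i - A i *m Psi i = 0
               & B i *m Ups i - Psi i = 0]) ->
  exists ystar : 'cV[R]_q,
    [/\ unique (optimal_solution setT (fun y => \sum_i f i y)) ystar,
        unique (optimal_solution
                  [set Y : 'cV[R]_(N * q) |
                     (laplacian a *t (1%:M : 'M[R]_q)) *m Y = 0]%classic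
                  (fun Y => \sum_i f i (block Y i)))
               (ones_tens N ystar)
      & exists gamma1 gamma2 : R, [/\ 0 < gamma1, 0 < gamma2
          & forall (x : forall i, R -> 'cV[R]_(n i))
                   (rho v : 'I_N -> R -> 'cV[R]_q) (z : 'I_N -> R -> 'cV[R]_N),
              closed_loop_trajectory A B C K Ups Phi Psi f a gamma1 gamma2
                x rho v z ->
              converges_exponentially
                (fun t => stack (fun i => output C x i t))
                (ones_tens N ystar)]].
Proof.
move=> hf aE sc _ hK reg.
have [r ra] := balancing_exists N_gt0 aE sc.
have [ystar [crit opt copt]] := optimum_exists N_gt0 aE sc ra hf.
exists ystar; split=> //.
have [rp _ _] := ra.
have [r0 r0_gt0 r0_le] := pos_lower_bound rp.
have [c c_gt0 gap] := energy_gap ra aE sc.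
have mp i : 0 < m i by have [] := hf i.
have Mp i : 0 < M i by have [] := hf i.
have [m0 m0_gt0 m0_le] := pos_lower_bound mp.
pose i0 := Ordinal N_gt0.
pose M0 := \sum_i M i.
have M0_gt0 : 0 < M0 by apply: lt_le_trans (le_sum_pos i0 Mp).
have f_convex i : strongly_convex m0 (f i).
  by have [_ _ fc _ _] := hf i; exact: strongly_convexW (m0_le i) fc.
have f_lip i : globally_lipschitz M0 (grad (f i)).
  by have [_ _ _ _ fl] := hf i; exact: globally_lipschitzW (le_sum_pos i Mp) fl.
exists (gain1 c r0 m0 M0), (gain2 r0 m0 M0); split.
- exact: gain1_gt0.
- exact: gain2_gt0.
move=> x rho v z traj.
exact: (output_converges i0 aE sc ra r0_gt0 m0_gt0 M0_gt0 r0_le gap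
  f_convex f_lip crit hK reg traj).
Qed.
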